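(* Let $(A,L,\mathfrak a)$ be a Lie-Rinehart comonoid in $\mathcal C$. For any Lie comonoid $(\mathcal L,\mathfrak d)$ in $\mathcal C$ and any cocrossed homomorphism $\mathcal J:A\otimes\mathcal L\to L$, the category $\mathbf{WCMod}^{\mathcal C}_A(L)$ of weak comodules is a strict right module category over the monoidal category $\mathbf{CMod}_{\mathcal C}(\mathcal L)$ of $\mathcal L$-comodules, the action being the bifunctor $$\mathcal F_{\mathcal J}:\mathbf{WCMod}^{\mathcal C}_A(L)\times\mathbf{CMod}_{\mathcal C}(\mathcal L)\to\mathbf{WCMod}^{\mathcal C}_A(L),\qquad((M;p,q),(W,\nu))\mapsto(M\otimes W;p\vartriangleleft\nu,q\vartriangleleft\nu),$$ where $$p\vartriangleleft\nu=(\mathrm{id}_M\otimes c_{A,W})\circ(p\otimes\mathrm{id}_W),$$ $$q\vartriangleleft\nu=(\mathrm{id}_M\otimes c_{L,W})\circ(q\otimes\mathrm{id}_W)+(\mathrm{id}_M\otimes\mathrm{id}_W\otimes\mathcal J)\circ(\mathrm{id}_M\otimes c_{A,W}\otimes\mathrm{id}_{\mathcal L})\circ(p\otimes\nu),$$ and where on morphisms $\mathcal F_{\mathcal J}(\phi,\varphi)=\phi\otimes\varphi$ for every homomorphism of weak comodules $\phi:M\to M'$ and every homomorphism of $\mathcal L$-comodules $\varphi:W\to W'$.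
   Context: Standing setting: $\mathcal C=(\mathcal C,\otimes,I,c)$ is a strict symmetric monoidal category with unit $I$ and symmetric braiding $c_{V,W}:V\otimes W\to W\otimes V$; it is $\mathbb C$-linear (Hom sets are complex vector spaces; composition and tensor product of morphisms are bilinear) and left rigid (every object $V$ has a left dual $V^*$ with morphisms $b_V:I\to V\otimes V^*$, $d_V:V^*\otimes V\to I$ satisfying the zig-zag identities). A comonoid $(A,\Delta,\varepsilon)$ is coassociative and counital; it is cocommutative if $c_{A,A}\circ\Delta=\Delta$. A (right) $A$-comodule $(M,p)$, $p:M\to M\otimes A$, satisfies $(\mathrm{id}_M\otimes\Delta)\circ p=(p\otimes\mathrm{id}_A)\circ p$ and $(\mathrm{id}_M\otimes\varepsilon)\circ p=\mathrm{id}_M$. A Lie comonoid $(L,\delta)$ is an object with $\delta:L\to L\otimes L$ such that $\delta=-c_{L,L}\circ\delta$ and $(\mathrm{id}_L\otimes\delta)\circ\delta=(\delta\otimes\mathrm{id}_L)\circ\delta+(c_{L,L}\otimes\mathrm{id}_L)\circ(\mathrm{id}_L\otimes\delta)\circ\delta$. A (right) $L$-comodule $(W,\nu)$, $\nu:W\to W\otimes L$, satisfies $(\nu\otimes\mathrm{id}_L)\circ\nu=(\mathrm{id}_W\otimes\delta)\circ\nu+(\mathrm{id}_W\otimes c_{L,L})\circ(\nu\otimes\mathrm{id}_L)\circ\nu$. Homomorphisms of comodules are morphisms commuting with the coactions. $\mathbf{CMod}_{\mathcal C}(L)$, the category of $L$-comodules, is strict monoidal with $(M,p)\otimes(N,q)=(M\otimes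 N,p\odot q)$, $p\odot q=\mathrm{id}_M\otimes q+(\mathrm{id}_M\otimes c_{L,N})\circ(p\otimes\mathrm{id}_N)$, and unit $(I,\mathbf 0)$ ($\mathbf 0$ the zero morphism). A Lie-Rinehart comonoid $(A,L,\mathfrak a)$ consists of a cocommutative comonoid $(A,\Delta,\varepsilon)$, a Lie comonoid $(L,\delta)$, an $A$-comodule structure $\mathfrak b:L\to L\otimes A$ on $L$, and a morphism $\mathfrak a:A\to A\otimes L$ such that $(\mathrm{id}_A\otimes\mathfrak b)\circ\mathfrak a=(\mathfrak a\otimes\mathrm{id}_A)\circ\Delta$; $(\Delta\otimes\mathrm{id}_L)\circ\mathfrak a=(\mathrm{id}_A\otimes\mathfrak a)\circ\Delta+(\mathrm{id}_A\otimes c_{L,A})\circ(\mathfrak a\otimes\mathrm{id}_A)\circ\Delta$; $(\mathfrak a\otimes\mathrm{id}_L)\circ\mathfrak a=(\mathrm{id}_A\otimes\delta)\circ\mathfrak a+(\mathrm{id}_A\otimes c_{L,L})\circ(\mathfrak a\otimes\mathrm{id}_L)\circ\mathfrak a$; $(\mathfrak b\otimes\mathrm{id}_L)\circ\delta=(\mathrm{id}_L\otimes\mathfrak a)\circ\mathfrak b+(\mathrm{id}_L\otimes c_{L,A})\circ(\delta\otimes\mathrm{id}_A)\circ\mathfrak b$. A weak comodule $(M;p,q)$ over $(A,L,\mathfrak a)$ is an object $M$ with an $A$-comodule structure $p$ and an $L$-comodule structure $q$ such that $(p\otimes\mathrm{id}_L)\circ q=(\mathrm{id}_M\otimes\mathfrak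 a)\circ p+(\mathrm{id}_M\otimes c_{L,A})\circ(q\otimes\mathrm{id}_A)\circ p$. Homomorphisms of weak comodules are morphisms that are both $A$-comodule and $L$-comodule homomorphisms; the category is $\mathbf{WCMod}^{\mathcal C}_A(L)$. A cocrossed homomorphism is a morphism $\mathcal J:A\otimes\mathcal L\to L$ with $$\delta\circ\mathcal J=(\mathcal J\otimes\mathrm{id}_L)\circ(\mathrm{id}_A\otimes c_{L,\mathcal L})\circ(\mathfrak a\otimes\mathrm{id}_{\mathcal L})-(\mathrm{id}_L\otimes\mathcal J)\circ(c_{A,L}\otimes\mathrm{id}_{\mathcal L})\circ(\mathfrak a\otimes\mathrm{id}_{\mathcal L})+(\mathcal J\otimes\mathcal J)\circ(\mathrm{id}_A\otimes c_{A,\mathcal L}\otimes\mathrm{id}_{\mathcal L})\circ(\Delta\otimes\mathfrak d).$$ A right module category over a strict monoidal category $\mathcal D$ is a category $\mathcal M$ with a bifunctor $\vartriangleleft:\mathcal M\times\mathcal D\to\mathcal M$ and natural isomorphisms $Z\vartriangleleft(X\otimes Y)\cong(Z\vartriangleleft X)\vartriangleleft Y$ and $Z\vartriangleleft I\cong Z$ satisfying the usual pentagon and triangle axioms; it is strict if these are all identities. *)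

(* Defs.v *)
From HB Require Import structures.
From mathcomp Require Import all_boot all_order all_algebra.
From mathcomp Require Import boolp reals.
From mathcomp Require Import complex.

Set Implicit Arguments.
Unset Strict Implicit.
Unset Printing Implicit Defensive.

Import GRing.Theory.
Local Open Scope ring_scope.

Declare Scope cat_scope.
Delimit Scope cat_scope with cat.

Record category := Category {
  ob :> Type;
  mor : ob -> ob -> Type;
  idm : forall X, mor X X;
  mcomp : forall X Y Z, mor Y Z -> mor X Y -> mor X Z;
  comp1m : forall X Y (f : mor X Y), mcomp (idm Y) f = f;
  compm1 : forall X Y (f : mor X Y), mcomp f (idm X) = f;
  compA : forall X Y Z W (h : mor Z W) (g : mor Y Z) (f : mor X Y),
    mcomp h (mcomp g f) = mcomp (mcomp h g) f }.

Arguments mor {c} X Y.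
Arguments idm {c} X.
Arguments mcomp {c X Y Z} g f.

Notation "g ∘ f" := (mcomp g f) (at level 40, left associativity) : cat_scope.
Local Open Scope cat_scope.

(* In a strict monoidal category the coherence isomorphisms are identities,
   but only along an equality of objects that need not be definitional:
   [eqm e] is the identity morphism read along such an equality. *)
Definition eqm (C : category) (X Y : C) (e : X = Y) : mor X Y :=
  match e in _ = Y' return mor X Y' with erefl => idm X end.

Definition is_iso (C : category) (X Y : C) (f : mor X Y) : Prop :=
  exists g : mor Y X, g ∘ f = idm X /\ f ∘ g = idm Y.

Record bifunctor (C D E : category) := Bifunctor {
  bf_ob :> C -> D -> E;
  bf_hom : forall X X' Y Y',
    mor X X' -> mor Y Y' -> mor (bf_ob X Y) (bf_ob X' Y');
  bf_id : forall X Y, bf_hom (idm X) (idm Y) = idm (bf_ob X Y);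
  bf_comp : forall X X' X'' Y Y' Y''
      (f' : mor X' X'') (f : mor X X') (g' : mor Y' Y'') (g : mor Y Y'),
    bf_hom (f' ∘ f) (g' ∘ g) = bf_hom f' g' ∘ bf_hom f g }.

Arguments bf_hom {C D E} b {X X' Y Y'} f g.

(* The pentagon and triangle axioms are omitted: they hold automatically,
   since any two parallel morphisms of the form [eqm _] are equal. *)
Record strict_monoidal := StrictMonoidal {
  sm_cat :> category;
  tens : bifunctor sm_cat sm_cat sm_cat;
  unit_ob : sm_cat;
  tensA : forall X Y Z, tens (tens X Y) Z = tens X (tens Y Z);
  tens1X : forall X, tens unit_ob X = X;
  tensX1 : forall X, tens X unit_ob = X;
  tensmA : forall X X' Y Y' Z Z'
      (f : mor X X') (g : mor Y Y') (h : mor Z Z'),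
    eqm (tensA X' Y' Z') ∘ bf_hom tens (bf_hom tens f g) h
    = bf_hom tens f (bf_hom tens g h) ∘ eqm (tensA X Y Z);
  tens1m : forall X X' (f : mor X X'),
    eqm (tens1X X') ∘ bf_hom tens (idm unit_ob) f = f ∘ eqm (tens1X X);
  tensm1 : forall X X' (f : mor X X'),
    eqm (tensX1 X') ∘ bf_hom tens f (idm unit_ob) = f ∘ eqm (tensX1 X) }.

Arguments unit_ob {s}.

Notation "X ⊗ Y" := (bf_ob (tens _) X Y)
  (at level 32, left associativity) : cat_scope.
Notation "f ⊠ g" := (bf_hom (tens _) f g)
  (at level 32, left associativity) : cat_scope.

Definition asc (C : strict_monoidal) (X Y Z : C) :
  mor ((X ⊗ Y) ⊗ Z) (X ⊗ (Y ⊗ Z)) := eqm (tensA X Y Z).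
Definition ascV (C : strict_monoidal) (X Y Z : C) :
  mor (X ⊗ (Y ⊗ Z)) ((X ⊗ Y) ⊗ Z) := eqm (esym (tensA X Y Z)).
Definition lun (C : strict_monoidal) (X : C) : mor (unit_ob ⊗ X) X :=
  eqm (tens1X X).
Definition run (C : strict_monoidal) (X : C) : mor (X ⊗ unit_ob) X :=
  eqm (tensX1 X).

Record strict_symmetric := StrictSymmetric {
  ss_sm :> strict_monoidal;
  braid : forall X Y : ss_sm, mor (X ⊗ Y) (Y ⊗ X);
  braid_nat : forall (X X' Y Y' : ss_sm) (f : mor X X') (g : mor Y Y'),
    braid X' Y' ∘ (f ⊠ g) = (g ⊠ f) ∘ braid X Y;
  braidK : forall X Y, braid Y X ∘ braid X Y = idm (X ⊗ Y);
  hexagon : forall X Y Z,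
    asc Y Z X ∘ braid X (Y ⊗ Z) ∘ asc X Y Z
    = (idm Y ⊠ braid X Z) ∘ asc Y X Z ∘ (braid X Y ⊠ idm Z) }.

Arguments braid {s} X Y.

(* Complex vector space structures on the hom-sets, before bilinearity. *)
Record hom_spaces (R : realType) := HomSpaces {
  hs_cat :> strict_symmetric;
  hs_lmod : forall X Y : hs_cat, GRing.Lmodule R[i] (mor X Y) }.

HB.instance Definition _ (R : realType) (C : hom_spaces R) (X Y : C) :=
  hs_lmod X Y.

Record tensor_category (R : realType) := TensorCategory {
  tc_hs :> hom_spaces R;
  comp_linearl : forall (X Y Z : tc_hs) (f : mor X Y),
    linear (fun g : mor Y Z => g ∘ f);
  comp_linearr : forall (X Y Z : tc_hs) (g : mor Y Z),
    linear (fun f : mor X Y => g ∘ f);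
  tens_linearl : forall (X X' Y Y' : tc_hs) (g : mor Y Y'),
    linear (fun f : mor X X' => f ⊠ g);
  tens_linearr : forall (X X' Y Y' : tc_hs) (f : mor X X'),
    linear (fun g : mor Y Y' => f ⊠ g);
  ldual : tc_hs -> tc_hs;
  coev : forall V, mor unit_ob (V ⊗ ldual V);
  ev : forall V, mor (ldual V ⊗ V) unit_ob;
  zigzag : forall V,
    run V ∘ (idm V ⊠ ev V) ∘ asc V (ldual V) V ∘ (coev V ⊠ idm V) = lun V;
  zigzag_dual : forall V,
    lun (ldual V) ∘ (ev V ⊠ idm (ldual V)) ∘ ascV (ldual V) V (ldual V)
      ∘ (idm (ldual V) ⊠ coev V) = run (ldual V) }.

(* id_X ⊗ c_{Y,Z} ⊗ id_W *)
Definition mid_braid (C : strict_symmetric) (X Y Z W : C) :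
    mor ((X ⊗ Y) ⊗ (Z ⊗ W)) ((X ⊗ Z) ⊗ (Y ⊗ W)) :=
  asc (X ⊗ Z) Y W ∘ (ascV X Z Y ⊠ idm W)
    ∘ ((idm X ⊠ braid Y Z) ⊠ idm W)
    ∘ (asc X Y Z ⊠ idm W) ∘ ascV (X ⊗ Y) Z W.

Record comonoid (R : realType) (C : tensor_category R) := Comonoid {
  cm_ob :> C;
  cm_delta : mor cm_ob (cm_ob ⊗ cm_ob);
  cm_eps : mor cm_ob unit_ob;
  cm_coassoc : asc cm_ob cm_ob cm_ob ∘ (cm_delta ⊠ idm cm_ob) ∘ cm_delta
               = (idm cm_ob ⊠ cm_delta) ∘ cm_delta;
  cm_counitl : lun cm_ob ∘ (cm_eps ⊠ idm cm_ob) ∘ cm_delta = idm cm_ob;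
  cm_counitr : run cm_ob ∘ (idm cm_ob ⊠ cm_eps) ∘ cm_delta = idm cm_ob }.

Definition cocommutative (R : realType) (C : tensor_category R)
    (A : comonoid C) : Prop :=
  braid A A ∘ cm_delta A = cm_delta A.

Definition is_comodule (R : realType) (C : tensor_category R)
    (A : comonoid C) (M : C) (p : mor M (M ⊗ A)) : Prop :=
  (idm M ⊠ cm_delta A) ∘ p = asc M A A ∘ (p ⊠ idm A) ∘ p
  /\ run M ∘ (idm M ⊠ cm_eps A) ∘ p = idm M.

Record lie_comonoid (R : realType) (C : tensor_category R) := LieComonoid {
  lc_ob :> C;
  cobr : mor lc_ob (lc_ob ⊗ lc_ob);
  cobr_anti : cobr = - (braid lc_ob lc_ob ∘ cobr);
  cobr_jacobi :
    (idm lc_ob ⊠ cobr) ∘ cobr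
    = asc lc_ob lc_ob lc_ob ∘ (cobr ⊠ idm lc_ob) ∘ cobr
      + asc lc_ob lc_ob lc_ob ∘ (braid lc_ob lc_ob ⊠ idm lc_ob)
          ∘ ascV lc_ob lc_ob lc_ob ∘ (idm lc_ob ⊠ cobr) ∘ cobr }.

Definition is_lie_comodule (R : realType) (C : tensor_category R)
    (L : lie_comonoid C) (W : C) (nu : mor W (W ⊗ L)) : Prop :=
  asc W L L ∘ (nu ⊠ idm L) ∘ nu
  = (idm W ⊠ cobr L) ∘ nu
    + (idm W ⊠ braid L L) ∘ asc W L L ∘ (nu ⊠ idm L) ∘ nu.

Definition is_coaction_hom (C : strict_monoidal) (A M M' : C)
    (p : mor M (M ⊗ A)) (p' : mor M' (M' ⊗ A)) (f : mor M M') : Prop :=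
  p' ∘ f = (f ⊠ idm A) ∘ p.

Definition coaction_tens (R : realType) (C : tensor_category R) (L M N : C)
    (p : mor M (M ⊗ L)) (q : mor N (N ⊗ L)) : mor (M ⊗ N) ((M ⊗ N) ⊗ L) :=
  ascV M N L ∘ (idm M ⊠ q)
  + ascV M N L ∘ (idm M ⊠ braid L N) ∘ asc M L N ∘ (p ⊠ idm N).

Record lie_comodule (R : realType) (C : tensor_category R)
    (L : lie_comonoid C) := LieComodule {
  lm_ob :> C;
  lm_coact : mor lm_ob (lm_ob ⊗ L);
  lm_axiom : is_lie_comodule lm_coact }.

Record lie_comodule_hom (R : realType) (C : tensor_category R)
    (L : lie_comonoid C) (M N : lie_comodule L) := LieComoduleHom {
  lmh :> mor M N;
  lmh_axiom : is_coaction_hom (lm_coact M) (lm_coact N) lmh }.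

Record lie_rinehart (R : realType) (C : tensor_category R) := LieRinehart {
  lr_A : comonoid C;
  lr_L : lie_comonoid C;
  lr_b : mor lr_L (lr_L ⊗ lr_A);
  lr_a : mor lr_A (lr_A ⊗ lr_L);
  lr_cocomm : cocommutative lr_A;
  lr_comodule : is_comodule lr_b;
  lr_anchor_colinear :
    (idm lr_A ⊠ lr_b) ∘ lr_a
    = asc lr_A lr_L lr_A ∘ (lr_a ⊠ idm lr_A) ∘ cm_delta lr_A;
  lr_anchor_coderivation :
    asc lr_A lr_A lr_L ∘ (cm_delta lr_A ⊠ idm lr_L) ∘ lr_a
    = (idm lr_A ⊠ lr_a) ∘ cm_delta lr_A
      + (idm lr_A ⊠ braid lr_L lr_A) ∘ asc lr_A lr_L lr_A
          ∘ (lr_a ⊠ idm lr_A) ∘ cm_delta lr_A;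
  lr_anchor_lie :
    asc lr_A lr_L lr_L ∘ (lr_a ⊠ idm lr_L) ∘ lr_a
    = (idm lr_A ⊠ cobr lr_L) ∘ lr_a
      + (idm lr_A ⊠ braid lr_L lr_L) ∘ asc lr_A lr_L lr_L
          ∘ (lr_a ⊠ idm lr_L) ∘ lr_a;
  lr_leibniz :
    asc lr_L lr_A lr_L ∘ (lr_b ⊠ idm lr_L) ∘ cobr lr_L
    = (idm lr_L ⊠ lr_a) ∘ lr_b
      + (idm lr_L ⊠ braid lr_L lr_A) ∘ asc lr_L lr_L lr_A
          ∘ (cobr lr_L ⊠ idm lr_A) ∘ lr_b }.

Definition is_weak_comodule (R : realType) (C : tensor_category R)
    (P : lie_rinehart C) (M : C)
    (p : mor M (M ⊗ lr_A P)) (q : mor M (M ⊗ lr_L P)) : Prop :=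
  [/\ is_comodule p, is_lie_comodule q
    & asc M (lr_A P) (lr_L P) ∘ (p ⊠ idm (lr_L P)) ∘ q
      = (idm M ⊠ lr_a P) ∘ p
        + (idm M ⊠ braid (lr_L P) (lr_A P)) ∘ asc M (lr_L P) (lr_A P)
            ∘ (q ⊠ idm (lr_A P)) ∘ p].

Record weak_comodule (R : realType) (C : tensor_category R)
    (P : lie_rinehart C) := WeakComodule {
  wc_ob :> C;
  wc_p : mor wc_ob (wc_ob ⊗ lr_A P);
  wc_q : mor wc_ob (wc_ob ⊗ lr_L P);
  wc_axiom : is_weak_comodule wc_p wc_q }.

Record weak_comodule_hom (R : realType) (C : tensor_category R)
    (P : lie_rinehart C) (M N : weak_comodule P) := WeakComoduleHom {
  wch :> mor M N;
  wch_p : is_coaction_hom (wc_p M) (wc_p N) wch;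
  wch_q : is_coaction_hom (wc_q M) (wc_q N) wch }.

Definition cocrossed_hom (R : realType) (C : tensor_category R)
    (P : lie_rinehart C) (K : lie_comonoid C)
    (J : mor (lr_A P ⊗ K) (lr_L P)) : Prop :=
  cobr (lr_L P) ∘ J
  = (J ⊠ idm (lr_L P)) ∘ ascV (lr_A P) K (lr_L P)
      ∘ (idm (lr_A P) ⊠ braid (lr_L P) K) ∘ asc (lr_A P) (lr_L P) K
      ∘ (lr_a P ⊠ idm K)
    - (idm (lr_L P) ⊠ J) ∘ asc (lr_L P) (lr_A P) K
      ∘ (braid (lr_A P) (lr_L P) ⊠ idm K) ∘ (lr_a P ⊠ idm K)
    + (J ⊠ J) ∘ mid_braid (lr_A P) (lr_A P) K K ∘ (cm_delta (lr_A P) ⊠ cobr K).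

Lemma reas (D : category) (X Y Z : D) (f : mor Y Z) (g : mor X Y) (r : mor X Z) :
  f ∘ g = r -> forall W (x : mor W X), f ∘ (g ∘ x) = r ∘ x.
Proof. by move=> <- W x; rewrite compA. Qed.

Section Coherence.
Context {C : strict_monoidal}.
Implicit Types X Y Z W : C.

Lemma eqm_irr (D : category) (X Y : D) (e e' : X = Y) : eqm e = eqm e'.
Proof. by rewrite (Prop_irrelevance e e'). Qed.

Lemma eqm_comp (D : category) (X Y Z : D) (e : X = Y) (e' : Y = Z) :
  eqm e' ∘ eqm e = eqm (etrans e e').
Proof. by case: _ / e'; rewrite comp1m. Qed.

Lemma eqm_id (D : category) (X : D) (e : X = X) : eqm e = idm X.
Proof. by rewrite (eqm_irr e erefl). Qed.

Lemma eqm_tensl X Y Z (e : X = Y) :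
  eqm e ⊠ idm Z = eqm (congr1 (fun T => T ⊗ Z) e).
Proof. by case: _ / e; rewrite bf_id. Qed.

Lemma eqm_tensr X Y Z (e : X = Y) :
  idm Z ⊠ eqm e = eqm (congr1 (fun T => Z ⊗ T) e).
Proof. by case: _ / e; rewrite bf_id. Qed.

Lemma ascK X Y Z : ascV X Y Z ∘ asc X Y Z = idm _.
Proof. by rewrite eqm_comp eqm_id. Qed.

Lemma ascVK X Y Z : asc X Y Z ∘ ascV X Y Z = idm _.
Proof. by rewrite eqm_comp eqm_id. Qed.

Lemma pentagon X Y Z W :
  asc X Y (Z ⊗ W) ∘ asc (X ⊗ Y) Z W
  = (idm X ⊠ asc Y Z W) ∘ asc X (Y ⊗ Z) W ∘ (asc X Y Z ⊠ idm W).
Proof. rewrite eqm_tensl eqm_tensr !eqm_comp; exact: eqm_irr. Qed.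

Lemma triangle X Y : (idm X ⊠ lun Y) ∘ asc X unit_ob Y = run X ⊠ idm Y.
Proof. rewrite eqm_tensl eqm_tensr !eqm_comp; exact: eqm_irr. Qed.

Lemma lun_asc X Y : lun (X ⊗ Y) ∘ asc unit_ob X Y = lun X ⊠ idm Y.
Proof. rewrite eqm_tensl !eqm_comp; exact: eqm_irr. Qed.

Lemma tens_exch X X' Y Y' (f : mor X X') (g : mor Y Y') :
  (f ⊠ idm Y') ∘ (idm X ⊠ g) = (idm X' ⊠ g) ∘ (f ⊠ idm Y).
Proof. by rewrite -!bf_comp !comp1m !compm1. Qed.

Lemma tensr_comp X Y Y' Y'' (g' : mor Y' Y'') (g : mor Y Y') :
  idm X ⊠ (g' ∘ g) = (idm X ⊠ g') ∘ (idm X ⊠ g).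
Proof. by rewrite -bf_comp comp1m. Qed.

Lemma tensl_comp X Y Y' Y'' (g' : mor Y' Y'') (g : mor Y Y') :
  (g' ∘ g) ⊠ idm X = (g' ⊠ idm X) ∘ (g ⊠ idm X).
Proof. by rewrite -bf_comp comp1m. Qed.

Lemma asc_l X X' Y Z (f : mor X X') :
  asc X' Y Z ∘ ((f ⊠ idm Y) ⊠ idm Z) = (f ⊠ idm (Y ⊗ Z)) ∘ asc X Y Z.
Proof. by rewrite /asc tensmA bf_id. Qed.

Lemma asc_m X Y Y' Z (f : mor Y Y') :
  asc X Y' Z ∘ ((idm X ⊠ f) ⊠ idm Z) = (idm X ⊠ (f ⊠ idm Z)) ∘ asc X Y Z.
Proof. by rewrite /asc tensmA. Qed.

Lemma asc_r X Y Z Z' (f : mor Z Z') :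
  asc X Y Z' ∘ (idm (X ⊗ Y) ⊠ f) = (idm X ⊠ (idm Y ⊠ f)) ∘ asc X Y Z.
Proof. by rewrite -(bf_id (tens _) X Y) /asc tensmA. Qed.

End Coherence.

(* [fam f Z] is [f] acting on the left of the right-nested word X ⊗ Z; in
   terms of such families the formulas for coactions hold without [asc]. *)
HB.lock Definition fam (C : strict_monoidal) (X Y A : C) (f : mor X (Y ⊗ A))
    (Z : C) : mor (X ⊗ Z) (Y ⊗ (A ⊗ Z)) :=
  asc Y A Z ∘ (f ⊠ idm Z).
Arguments fam {C X Y A} f Z.

Section Families.
Context {C : strict_monoidal}.
Implicit Types X Y Z W : C.

Lemma asc_inj X Y Z W (f g : mor W ((X ⊗ Y) ⊗ Z)) :
  asc X Y Z ∘ f = asc X Y Z ∘ g -> f = g.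
Proof.
by move=> /(congr1 (mcomp (ascV X Y Z))); rewrite !compA !ascK !comp1m.
Qed.

Lemma asc_injr X Y Z W (f g : mor (X ⊗ (Y ⊗ Z)) W) :
  f ∘ asc X Y Z = g ∘ asc X Y Z -> f = g.
Proof.
move=> /(congr1 (fun h => h ∘ ascV X Y Z)).
by rewrite -!compA !ascVK !compm1.
Qed.

Lemma tens_unit_inj X Y (f g : mor X Y) :
  f ⊠ idm unit_ob = g ⊠ idm unit_ob -> f = g.
Proof.
have runV Z : run Z ∘ eqm (esym (tensX1 Z)) = idm Z by rewrite eqm_comp eqm_id.
move=> fg; rewrite -[f]compm1 -[g]compm1 -!runV !compA /run.
by rewrite -!tensm1 fg.
Qed.

Lemma fam_inj X Y A (f g : mor X (Y ⊗ A)) : (forall Z, fam f Z = fam g Z) -> f = g.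
Proof.
move=> fg; apply/tens_unit_inj/asc_inj.
by move: (fg unit_ob); rewrite fam.unlock.
Qed.

Lemma fam_nat X Y A (f : mor X (Y ⊗ A)) Z Z' (h : mor Z Z') :
  fam f Z' ∘ (idm X ⊠ h) = (idm Y ⊠ (idm A ⊠ h)) ∘ fam f Z.
Proof. by rewrite fam.unlock -compA tens_exch compA asc_r -!compA. Qed.

End Families.

HB.lock Definition bfam (C : strict_symmetric) (X Y Z : C) :
    mor (X ⊗ (Y ⊗ Z)) (Y ⊗ (X ⊗ Z)) :=
  asc Y X Z ∘ (braid X Y ⊠ idm Z) ∘ ascV X Y Z.
Arguments bfam {C} X Y Z.

Section Braiding.
Context {C : strict_symmetric}.
Implicit Types X Y Z W N : C.

Lemma bfam_asc X Y Z : bfam X Y Z ∘ asc X Y Z = asc Y X Z ∘ (braid X Y ⊠ idm Z).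
Proof. by rewrite bfam.unlock -compA ascK compm1. Qed.

Lemma bfamK X Y Z : bfam Y X Z ∘ bfam X Y Z = idm _.
Proof.
apply: asc_injr; rewrite -compA bfam_asc compA bfam_asc -compA -tensl_comp.
by rewrite braidK bf_id compm1 comp1m.
Qed.

Lemma bfam_r X Y Z Z' (h : mor Z Z') :
  bfam X Y Z' ∘ (idm X ⊠ (idm Y ⊠ h)) = (idm Y ⊠ (idm X ⊠ h)) ∘ bfam X Y Z.
Proof.
apply: asc_injr; rewrite -compA -asc_r compA bfam_asc -compA tens_exch.
rewrite compA asc_r -!compA. by rewrite bfam_asc.
Qed.

Lemma bfam_l X X' Y Z (f : mor X X') :
  bfam X' Y Z ∘ (f ⊠ idm (Y ⊗ Z)) = (idm Y ⊠ (f ⊠ idm Z)) ∘ bfam X Y Z.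
Proof.
apply: asc_injr; rewrite -compA -asc_l compA bfam_asc -compA -tensl_comp.
by rewrite braid_nat tensl_comp compA asc_m -!compA bfam_asc.
Qed.

Lemma bfam_m X Y Y' Z (f : mor Y Y') :
  bfam X Y' Z ∘ (idm X ⊠ (f ⊠ idm Z)) = (f ⊠ idm (X ⊗ Z)) ∘ bfam X Y Z.
Proof.
apply: asc_injr; rewrite -compA -asc_m compA bfam_asc -compA -tensl_comp.
by rewrite braid_nat tensl_comp compA asc_l -!compA bfam_asc.
Qed.

Lemma bfam_hex X Y Z W :
  asc Y Z (X ⊗ W) ∘ bfam X (Y ⊗ Z) W
  = (idm Y ⊠ bfam X Z W) ∘ bfam X Y (Z ⊗ W) ∘ (idm X ⊠ asc Y Z W).
Proof.
apply: asc_injr.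
suff E : asc Y Z (X ⊗ W) ∘ bfam X (Y ⊗ Z) W ∘ asc X (Y ⊗ Z) W
    ∘ (asc X Y Z ⊠ idm W)
  = (idm Y ⊠ bfam X Z W) ∘ bfam X Y (Z ⊗ W) ∘ (idm X ⊠ asc Y Z W)
    ∘ asc X (Y ⊗ Z) W ∘ (asc X Y Z ⊠ idm W).
  move: E => /(congr1 (fun h => h ∘ (ascV X Y Z ⊠ idm W))).
  by rewrite -!compA -!tensl_comp !ascVK !bf_id !compm1.
rewrite -!compA (reas (bfam_asc _ _ _)) -!compA (reas (pentagon _ _ _ _)).
rewrite -!compA -!tensl_comp [asc Y Z X ∘ _]compA hexagon -!compA !tensl_comp.
rewrite (reas (asc_m _ _ _)) -!compA.
have := pentagon X Y Z W; rewrite -!compA => <-.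
rewrite (reas (bfam_asc _ _ _)) -!compA -asc_l (reas (pentagon _ _ _ _)).
have h : (idm Y ⊠ bfam X Z W) ∘ (idm Y ⊠ asc X Z W)
    = (idm Y ⊠ asc Z X W) ∘ (idm Y ⊠ (braid X Z ⊠ idm W)).
  by rewrite -!tensr_comp bfam_asc.
by rewrite -!compA (reas h) -!compA.
Qed.
End Braiding.

Section BraidingFamilies.
Context {C : strict_symmetric}.
Implicit Types X Y Z W N A : C.

Lemma bfam_hexl X Y N Z :
  (idm N ⊠ asc X Y Z) ∘ bfam (X ⊗ Y) N Z
  = bfam X N (Y ⊗ Z) ∘ ((idm X ⊠ bfam Y N Z) ∘ asc X Y (N ⊗ Z)).
Proof.
have H := bfam_hex N X Y Z.
have K : (idm X ⊠ bfam Y N Z) ∘ (idm X ⊠ bfam N Y Z) = idm _.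
  by rewrite -tensr_comp bfamK bf_id.
have {}H : bfam X N (Y ⊗ Z) ∘ ((idm X ⊠ bfam Y N Z)
    ∘ (asc X Y (N ⊗ Z) ∘ bfam N (X ⊗ Y) Z)) = idm N ⊠ asc X Y Z.
  by rewrite H -!compA (reas K) comp1m (reas (bfamK _ _ _)) comp1m.
by rewrite -H -!compA bfamK compm1.
Qed.

Lemma fam_bfam X Y A (f : mor X (Y ⊗ A)) N Z :
  (idm N ⊠ fam f Z) ∘ bfam X N Z
  = bfam Y N (A ⊗ Z) ∘ ((idm Y ⊠ bfam A N Z) ∘ fam f (N ⊗ Z)).
Proof.
rewrite fam.unlock tensr_comp -compA -bfam_l compA bfam_hexl.
by rewrite -!compA.
Qed.

Lemma fam_bfam_r X Y A (f : mor X (Y ⊗ A)) N Z :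
  fam f (N ⊗ Z) ∘ bfam N X Z
  = (idm Y ⊠ bfam N A Z) ∘ (bfam N Y (A ⊗ Z) ∘ (idm N ⊠ fam f Z)).
Proof.
rewrite fam.unlock tensr_comp -compA -bfam_m compA bfam_hex.
by rewrite -!compA.
Qed.

Lemma yang_baxter X Y N Z :
  (idm N ⊠ bfam X Y Z) ∘ (bfam X N (Y ⊗ Z) ∘ (idm X ⊠ bfam Y N Z))
  = bfam Y N (X ⊗ Z) ∘ ((idm Y ⊠ bfam X N Z) ∘ bfam X Y (N ⊗ Z)).
Proof.
apply: asc_injr; rewrite -!compA -bfam_hexl bfam_asc.
rewrite [(idm Y ⊠ _) ∘ (_ ∘ _)]compA [bfam Y N _ ∘ _]compA -bfam_hexl.
by rewrite -[RHS]compA bfam_l !compA -!tensr_comp bfam_asc.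
Qed.

End BraidingFamilies.

Section Linear.
Context {R : realType} {C : tensor_category R}.
Implicit Types X Y Z W : C.

Lemma compDl X Y Z (f : mor X Y) (g g' : mor Y Z) :
  (g + g') ∘ f = g ∘ f + g' ∘ f.
Proof. by have := comp_linearl f 1 g g'; rewrite !scale1r. Qed.

Lemma compDr X Y Z (f f' : mor X Y) (g : mor Y Z) :
  g ∘ (f + f') = g ∘ f + g ∘ f'.
Proof. by have := comp_linearr g 1 f f'; rewrite !scale1r. Qed.

Lemma tensDl X X' Y Y' (f f' : mor X X') (g : mor Y Y') :
  (f + f') ⊠ g = f ⊠ g + f' ⊠ g.
Proof. by have := tens_linearl g 1 f f'; rewrite !scale1r. Qed.

Lemma tensDr X X' Y Y' (f : mor X X') (g g' : mor Y Y') :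
  f ⊠ (g + g') = f ⊠ g + f ⊠ g'.
Proof. by have := tens_linearr f 1 g g'; rewrite !scale1r. Qed.

Lemma comp0l X Y Z (f : mor X Y) : (0 : mor Y Z) ∘ f = 0.
Proof. by apply: (addrI (0 ∘ f)); rewrite -compDl !addr0. Qed.

Lemma comp0r X Y Z (g : mor Y Z) : g ∘ (0 : mor X Y) = 0.
Proof. by apply: (addrI (g ∘ 0)); rewrite -compDr !addr0. Qed.

Lemma tens0l X X' Y Y' (g : mor Y Y') : (0 : mor X X') ⊠ g = 0.
Proof. by apply: (addrI (0 ⊠ g)); rewrite -tensDl !addr0. Qed.

Lemma tens0r X X' Y Y' (f : mor X X') : f ⊠ (0 : mor Y Y') = 0.
Proof. by apply: (addrI (f ⊠ 0)); rewrite -tensDr !addr0. Qed.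

Lemma famD X Y A (f g : mor X (Y ⊗ A)) Z : fam (f + g) Z = fam f Z + fam g Z.
Proof. by rewrite fam.unlock tensDl compDr. Qed.

Lemma fam0 X Y A Z : fam (0 : mor X (Y ⊗ A)) Z = 0.
Proof. by rewrite fam.unlock tens0l comp0r. Qed.

End Linear.

Lemma is_coaction_homP (D : strict_monoidal) (A M M' : D)
    (p : mor M (M ⊗ A)) (p' : mor M' (M' ⊗ A)) (f : mor M M') :
  is_coaction_hom p p' f <->
  forall Z : D, fam p' Z ∘ (f ⊠ idm Z) = (f ⊠ idm (A ⊗ Z)) ∘ fam p Z.
Proof.
have E Z : (f ⊠ idm (A ⊗ Z)) ∘ fam p Z = fam ((f ⊠ idm A) ∘ p) Z.
  by rewrite fam.unlock compA -asc_l -!compA -tensl_comp.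
have E' Z : fam p' Z ∘ (f ⊠ idm Z) = fam (p' ∘ f) Z.
  by rewrite fam.unlock tensl_comp compA.
split=> [H Z|H]; first by rewrite E E' H.
by apply: fam_inj => Z; rewrite -E -E' H.
Qed.

Section LieComodules.
Context {R : realType} {C : tensor_category R} {L : lie_comonoid C}.
Implicit Types (M N P Z : C).

Lemma is_lie_comoduleP M (p : mor M (M ⊗ L)) :
  is_lie_comodule p <->
  forall Z, fam p (L ⊗ Z) ∘ fam p Z
    = (idm M ⊠ fam (cobr L) Z) ∘ fam p Z
      + (idm M ⊠ bfam L L Z) ∘ (fam p (L ⊗ Z) ∘ fam p Z).
Proof.
have E1 Z : (idm M ⊠ asc L L Z) ∘ fam (asc M L L ∘ (p ⊠ idm L) ∘ p) Z
    = fam p (L ⊗ Z) ∘ fam p Z.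
  rewrite fam.unlock !tensl_comp -!compA [in RHS](reas (esym (asc_l _ _ _))).
  have := pentagon M L L Z; rewrite -!compA => H.
  by rewrite (reas H) -!compA.
have E2 Z : (idm M ⊠ asc L L Z) ∘ fam ((idm M ⊠ cobr L) ∘ p) Z
    = (idm M ⊠ fam (cobr L) Z) ∘ fam p Z.
  by rewrite fam.unlock !tensl_comp tensr_comp -!compA (reas (asc_m _ _ _)) -!compA.
have E3 Z f : (idm M ⊠ asc L L Z) ∘ fam ((idm M ⊠ braid L L) ∘ f) Z
    = (idm M ⊠ bfam L L Z) ∘ ((idm M ⊠ asc L L Z) ∘ fam (f : mor M _) Z).
  rewrite fam.unlock !tensl_comp [X in _ ∘ X]compA asc_m.
  by rewrite !compA -!tensr_comp bfam_asc.
split=> [H Z|H].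
  by rewrite -E1 {1}H famD compDr E2 -!compA E3.
apply: fam_inj => Z.
have asc_injr' f g : (idm M ⊠ asc L L Z) ∘ f = (idm M ⊠ asc L L Z) ∘ g ->
    f = g :> mor (M ⊗ Z) _.
  move=> /(congr1 (mcomp (idm M ⊠ ascV L L Z))).
  by rewrite !compA -!tensr_comp ascK bf_id !comp1m.
apply: asc_injr'; rewrite E1 H famD compDr E2 -!compA E3.
by rewrite [asc M L L ∘ _]compA E1.
Qed.

(* The family of the coaction p ⊙ q, conjugated by [asc]. *)
Definition tens_fam M N (p : mor M (M ⊗ L)) (q : mor N (N ⊗ L)) Z :
    mor (M ⊗ (N ⊗ Z)) (M ⊗ (N ⊗ (L ⊗ Z))) :=
  (idm M ⊠ fam q Z) + (idm M ⊠ bfam L N Z) ∘ fam p (N ⊗ Z).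

Lemma fam_coaction_tens M N (p : mor M (M ⊗ L)) (q : mor N (N ⊗ L)) Z :
  asc M N (L ⊗ Z) ∘ fam (coaction_tens p q) Z = tens_fam p q Z ∘ asc M N Z.
Proof.
rewrite famD compDr /tens_fam compDl.
have E f : asc M N (L ⊗ Z) ∘ fam (ascV M N L ∘ f) Z
    = (idm M ⊠ asc N L Z) ∘ (asc M (N ⊗ L) Z ∘ (f ⊠ idm Z))
    :> mor ((M ⊗ N) ⊗ Z) _.
  rewrite fam.unlock tensl_comp !compA pentagon.
  by rewrite -[X in X ∘ _]compA -tensl_comp ascVK bf_id compm1.
rewrite -!compA !E; congr (_ + _).
  by rewrite asc_m compA -tensr_comp fam.unlock.
rewrite !tensl_comp (reas (asc_m _ _ _)) -!compA.
rewrite [LHS]compA -tensr_comp -bfam_asc tensr_comp -!compA.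
have := pentagon M L N Z; rewrite -!compA => H.
rewrite fam.unlock -!compA -asc_l (reas H) -!compA.
by [].
Qed.

Lemma tens_fam_lie M N (p : mor M (M ⊗ L)) (q : mor N (N ⊗ L)) Z :
  is_lie_comodule p -> is_lie_comodule q ->
  tens_fam p q (L ⊗ Z) ∘ tens_fam p q Z
  = (idm M ⊠ (idm N ⊠ fam (cobr L) Z)) ∘ tens_fam p q Z
    + (idm M ⊠ (idm N ⊠ bfam L L Z))
        ∘ (tens_fam p q (L ⊗ Z) ∘ tens_fam p q Z).
Proof.
move=> /is_lie_comoduleP Hp /is_lie_comoduleP Hq.
rewrite /tens_fam !compDl !compDr -!compA.
set a := (_ ∘ (idm M ⊠ fam q Z)).
set b := (_ ∘ ((idm M ⊠ bfam L N Z) ∘ fam p (N ⊗ Z))).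
set c := ((idm M ⊠ bfam L N (L ⊗ Z)) ∘ _).
set d := ((idm M ⊠ bfam L N (L ⊗ Z)) ∘ (_ ∘ ((idm M ⊠ bfam L N Z) ∘ _))).
set t := (idm M ⊠ (idm N ⊠ bfam L L Z)).
set s := (idm M ⊠ (idm N ⊠ fam (cobr L) Z)).
have Ha : a = s ∘ (idm M ⊠ fam q Z) + t ∘ a.
  by rewrite /a /s /t -!tensr_comp -tensDr -Hq.
have tK : t ∘ t = idm _ by rewrite /t -!tensr_comp bfamK !bf_id.
have Hb : b = t ∘ c.
  rewrite /b /c /t fam_nat !compA -!tensr_comp; congr ((_ ⊠ _) ∘ _).
  by rewrite fam_bfam_r -!compA.
have Hc : c = t ∘ b by rewrite Hb compA tK comp1m.
have Hd : d = s ∘ ((idm M ⊠ bfam L N Z) ∘ fam p (N ⊗ Z)) + t ∘ d.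
  have E : d = (idm M ⊠ bfam L N (L ⊗ Z)) ∘ ((idm M ⊠ (idm L ⊠ bfam L N Z))
      ∘ (fam p (L ⊗ (N ⊗ Z)) ∘ fam p (N ⊗ Z))).
    by rewrite /d [fam p _ ∘ (_ ∘ _)]compA fam_nat -!compA.
  rewrite [in LHS]E Hp !compDr; congr (_ + _).
    by rewrite /s !compA -!tensr_comp fam_bfam -!compA.
  rewrite E /t !compA -!tensr_comp; congr (((_ ⊠ _) ∘ _) ∘ _).
  by rewrite -!compA -yang_baxter.
rewrite [LHS](_ : _ = s ∘ (idm M ⊠ fam q Z) + t ∘ a + t ∘ c
  + (t ∘ b + (s ∘ ((idm M ⊠ bfam L N Z) ∘ fam p (N ⊗ Z)) + t ∘ d))).
  move: (t ∘ a) (t ∘ b) (t ∘ c) (t ∘ d) (s ∘ _) (s ∘ _) => ta tb tc td v u.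
  rewrite -!addrA; congr (u + _); rewrite [tb + (v + _)]addrCA.
  by rewrite [tc + (v + _)]addrCA [ta + (v + _)]addrCA [tc + (tb + _)]addrCA.
by rewrite -Ha -Hb -Hc -Hd.
Qed.

Lemma coaction_tens_comodule M N (p : mor M (M ⊗ L)) (q : mor N (N ⊗ L)) :
  is_lie_comodule p -> is_lie_comodule q -> is_lie_comodule (coaction_tens p q).
Proof.
move=> Hp Hq; apply/is_lie_comoduleP => Z.
apply: asc_inj; rewrite compDr !(reas (asc_r _ _ _)) -!compA.
rewrite !(reas (fam_coaction_tens _ _ _)) -!compA !fam_coaction_tens.
by rewrite !compA {1}tens_fam_lie // compDl -!compA.
Qed.

Lemma coaction_tens_hom M M' N N' (p : mor M (M ⊗ L)) (p' : mor M' (M' ⊗ L))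
    (q : mor N (N ⊗ L)) (q' : mor N' (N' ⊗ L)) (f : mor M M') (g : mor N N') :
  is_coaction_hom p p' f -> is_coaction_hom q q' g ->
  is_coaction_hom (coaction_tens p q) (coaction_tens p' q') (f ⊠ g).
Proof.
move=> /is_coaction_homP Hp /is_coaction_homP Hq; apply/is_coaction_homP => Z.
apply: asc_inj; rewrite compA fam_coaction_tens -compA.
have A W : asc M' N' W ∘ ((f ⊠ g) ⊠ idm W) = (f ⊠ (g ⊠ idm W)) ∘ asc M N W.
  by rewrite /asc tensmA.
rewrite A (reas (A _)) -!compA fam_coaction_tens !compA; congr (_ ∘ _).
rewrite /tens_fam compDl compDr; congr (_ + _).
  by rewrite -!bf_comp Hq comp1m compm1.
have S W W' (h : mor W W') : f ⊠ h = (f ⊠ idm W') ∘ (idm M ⊠ h).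
  by rewrite -bf_comp comp1m compm1.
rewrite (S _ _ (g ⊠ idm Z)) -!compA (reas (Hp _)) -!compA fam_nat !compA.
by rewrite -!bf_comp !comp1m !compm1 bfam_m.
Qed.

Lemma coaction_tensA M N P (p : mor M (M ⊗ L)) (q : mor N (N ⊗ L))
    (r : mor P (P ⊗ L)) :
  is_coaction_hom (coaction_tens (coaction_tens p q) r)
    (coaction_tens p (coaction_tens q r)) (asc M N P).
Proof.
apply/is_coaction_homP => Z; apply: asc_inj.
have inj W X Y Z' (f g : mor W (M ⊗ ((X ⊗ Y) ⊗ Z'))) :
    (idm M ⊠ asc X Y Z') ∘ f = (idm M ⊠ asc X Y Z') ∘ g -> f = g.
  move=> /(congr1 (mcomp (idm M ⊠ ascV X Y Z'))).
  by rewrite !compA -!tensr_comp ascK bf_id !comp1m.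
apply: inj; rewrite (reas (fam_coaction_tens _ _ _)) !compA -pentagon.
rewrite -[RHS]compA fam_coaction_tens.
have E1 : (idm M ⊠ asc N P (L ⊗ Z)) ∘ tens_fam p (coaction_tens q r) Z
    = ((idm M ⊠ tens_fam q r Z)
       + (idm M ⊠ ((idm N ⊠ bfam L P Z) ∘ bfam L N (P ⊗ Z)))
           ∘ fam p (N ⊗ (P ⊗ Z))) ∘ (idm M ⊠ asc N P Z).
  rewrite compDl compDr -!tensr_comp fam_coaction_tens; congr (_ + _).
  by rewrite compA -tensr_comp bfam_hex -[RHS]compA fam_nat !tensr_comp -!compA.
have E2 : asc M N (P ⊗ (L ⊗ Z)) ∘ tens_fam (coaction_tens p q) r Z
    = ((idm M ⊠ (idm N ⊠ fam r Z))
       + (idm M ⊠ (idm N ⊠ bfam L P Z)) ∘ tens_fam p q (P ⊗ Z))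
      ∘ asc M N (P ⊗ Z).
  rewrite compDl compDr asc_r; congr (_ + _).
  by rewrite compA asc_r -!compA fam_coaction_tens.
rewrite E1 [RHS]compA E2 -!compA.
have := pentagon M N P Z; rewrite -!compA => <-.
rewrite !compA; congr (_ ∘ _ ∘ _).
by rewrite /tens_fam tensDr compDr !tensr_comp -!addrA !compA.
Qed.

Lemma lun_nat (D : strict_monoidal) (X Y : D) (f : mor X Y) :
  lun Y ∘ (idm unit_ob ⊠ f) = f ∘ lun X.
Proof. exact: tens1m. Qed.

Lemma bfam_unit (D : strict_symmetric) (X Z : D) :
  lun (X ⊗ Z) ∘ bfam X unit_ob Z = idm X ⊠ lun Z.
Proof.
have lunV (Y : D) : lun Y ∘ eqm (esym (tens1X Y)) = idm Y.
  by rewrite eqm_comp eqm_id.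
have E : lun (X ⊗ (unit_ob ⊗ Z)) ∘ bfam X unit_ob (unit_ob ⊗ Z)
    = idm X ⊠ lun (unit_ob ⊗ Z).
  have := bfam_m X Z (lun (unit_ob : D)).
  rewrite -!lun_asc tensr_comp -[RHS]compA bfam_hex !compA lun_nat.
  move=> /(congr1 (fun h => bfam unit_ob X Z ∘ h ∘ (idm X ⊠ ascV _ _ _))).
  rewrite -!compA -!tensr_comp ascVK bf_id !compm1.
  by rewrite !(reas (bfamK _ _ _)) !comp1m.
have cancel W (f g : mor (X ⊗ (unit_ob ⊗ Z)) W) :
    f ∘ (idm X ⊠ (idm unit_ob ⊠ lun Z)) = g ∘ (idm X ⊠ (idm unit_ob ⊠ lun Z))
    -> f = g.
  move=> /(congr1 (fun h => h ∘ (idm X ⊠ (idm unit_ob ⊠ eqm (esym (tens1X Z)))))).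
  by rewrite -!compA -!tensr_comp lunV !bf_id !compm1.
apply: cancel; rewrite -compA bfam_r compA lun_nat -compA E -!tensr_comp.
by rewrite lun_nat.
Qed.

Lemma coaction_tens1 M (q : mor M (M ⊗ L)) :
  is_coaction_hom (coaction_tens (0 : mor unit_ob (unit_ob ⊗ L)) q) q (lun M).
Proof.
apply/is_coaction_homP => Z; rewrite -!lun_asc -compA fam_coaction_tens.
by rewrite /tens_fam fam0 comp0r addr0 !compA lun_nat.
Qed.

Lemma coaction_tensX1 M (p : mor M (M ⊗ L)) :
  is_coaction_hom (coaction_tens p (0 : mor unit_ob (unit_ob ⊗ L))) p (run M).
Proof.
apply/is_coaction_homP => Z; rewrite -!triangle -compA fam_coaction_tens.
rewrite /tens_fam fam0 tens0r add0r !compA -tensr_comp bfam_unit.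
by rewrite fam_nat.
Qed.

Lemma coaction0_comodule :
  is_lie_comodule (0 : mor unit_ob (unit_ob ⊗ L)).
Proof. by rewrite /is_lie_comodule !comp0r addr0. Qed.

End LieComodules.

Section Categories.
Context {R : realType} {C : tensor_category R}.

Lemma is_coaction_hom_id (A M : C) (p : mor M (M ⊗ A)) :
  is_coaction_hom p p (idm M).
Proof. by rewrite /is_coaction_hom bf_id comp1m compm1. Qed.

Lemma is_coaction_hom_comp (A M M' M'' : C) (p : mor M (M ⊗ A))
    (p' : mor M' (M' ⊗ A)) (p'' : mor M'' (M'' ⊗ A))
    (g : mor M' M'') (f : mor M M') :
  is_coaction_hom p' p'' g -> is_coaction_hom p p' f ->
  is_coaction_hom p p'' (g ∘ f).
Proof.
rewrite /is_coaction_hom => Hg Hf.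
by rewrite compA Hg -compA Hf compA tensl_comp.
Qed.

Lemma lie_comodule_hom_ext (L : lie_comonoid C) (M N : lie_comodule L)
    (f g : lie_comodule_hom M N) : f = g :> mor M N -> f = g.
Proof.
by case: f g => f Hf [g Hg] /= E; subst g; rewrite (Prop_irrelevance Hf Hg).
Qed.

Lemma weak_comodule_hom_ext (P : lie_rinehart C) (M N : weak_comodule P)
    (f g : weak_comodule_hom M N) : f = g :> mor M N -> f = g.
Proof.
case: f g => f Hp Hq [g Hp' Hq'] /= E; subst g.
by rewrite (Prop_irrelevance Hp Hp') (Prop_irrelevance Hq Hq').
Qed.

Definition weak_comodule_id (P : lie_rinehart C) (M : weak_comodule P) :
    weak_comodule_hom M M :=
  WeakComoduleHom (is_coaction_hom_id (wc_p M)) (is_coaction_hom_id (wc_q M)).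

Definition weak_comodule_comp (P : lie_rinehart C) (M N K : weak_comodule P)
    (g : weak_comodule_hom N K) (f : weak_comodule_hom M N) :
    weak_comodule_hom M K :=
  WeakComoduleHom (is_coaction_hom_comp (wch_p g) (wch_p f))
    (is_coaction_hom_comp (wch_q g) (wch_q f)).

Definition WCMod (P : lie_rinehart C) : category.
Proof.
refine (@Category (weak_comodule P) (@weak_comodule_hom R C P)
  (@weak_comodule_id P) (@weak_comodule_comp P) _ _ _).
- by move=> M N f; apply: weak_comodule_hom_ext; exact: comp1m.
- by move=> M N f; apply: weak_comodule_hom_ext; exact: compm1.
- by move=> M N K Q h g f; apply: weak_comodule_hom_ext; exact: compA.
Defined.

Context (L : lie_comonoid C).

Definition lie_comodule_id (M : lie_comodule L) : lie_comodule_hom M M :=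
  LieComoduleHom (is_coaction_hom_id (lm_coact M)).

Definition lie_comodule_comp (M N K : lie_comodule L)
    (g : lie_comodule_hom N K) (f : lie_comodule_hom M N) :
    lie_comodule_hom M K :=
  LieComoduleHom (is_coaction_hom_comp (lmh_axiom g) (lmh_axiom f)).

Definition lie_comodule_cat : category.
Proof.
refine (@Category (lie_comodule L) (@lie_comodule_hom R C L)
  lie_comodule_id lie_comodule_comp _ _ _).
- by move=> M N f; apply: lie_comodule_hom_ext; exact: comp1m.
- by move=> M N f; apply: lie_comodule_hom_ext; exact: compm1.
- by move=> M N K Q h g f; apply: lie_comodule_hom_ext; exact: compA.
Defined.

Definition lie_comodule_tens (M N : lie_comodule L) : lie_comodule L :=
  @LieComodule R C L (lm_ob M ⊗ lm_ob N) (coaction_tens (lm_coact M) (lm_coact N))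
    (coaction_tens_comodule (lm_axiom M) (lm_axiom N)).

Definition lie_comodule_tensm (M M' N N' : lie_comodule L)
    (f : lie_comodule_hom M M') (g : lie_comodule_hom N N') :
    lie_comodule_hom (lie_comodule_tens M N) (lie_comodule_tens M' N') :=
  @LieComoduleHom R C L (lie_comodule_tens M N) (lie_comodule_tens M' N')
    (lmh f ⊠ lmh g) (coaction_tens_hom (lmh_axiom f) (lmh_axiom g)).

Definition lie_comodule_unit : lie_comodule L :=
  @LieComodule R C L unit_ob 0 coaction0_comodule.

Definition lie_comodule_bifunctor :
  bifunctor lie_comodule_cat lie_comodule_cat lie_comodule_cat.
Proof.
refine (@Bifunctor lie_comodule_cat lie_comodule_cat lie_comodule_cat
  lie_comodule_tens lie_comodule_tensm _ _).
- by move=> M N; apply: lie_comodule_hom_ext; exact: bf_id.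
- move=> M M' M'' N N' N'' f' f g' g; apply: lie_comodule_hom_ext.
  exact: bf_comp.
Defined.

Lemma lie_comodule_eq (M N : lie_comodule L) (e : lm_ob M = lm_ob N) :
  is_coaction_hom (lm_coact M) (lm_coact N) (eqm e) -> M = N.
Proof.
case: M N e => M p Hp [N q Hq] /= e; subst N.
rewrite /is_coaction_hom /= bf_id comp1m compm1 => E; subst q.
by rewrite (Prop_irrelevance Hp Hq).
Qed.

Lemma lmh_eqm (M N : lie_comodule_cat) (e : M = N)
    (e' : lm_ob M = lm_ob N) :
  lmh (eqm e : lie_comodule_hom M N) = eqm e'.
Proof. by case: _ / e e' => e'; rewrite (eqm_id e'). Qed.

Lemma lie_comodule_tensA (M N K : lie_comodule L) :
  lie_comodule_tens (lie_comodule_tens M N) K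
  = lie_comodule_tens M (lie_comodule_tens N K).
Proof.
apply: (@lie_comodule_eq (lie_comodule_tens (lie_comodule_tens M N) K)
  (lie_comodule_tens M (lie_comodule_tens N K))
  (tensA (lm_ob M) (lm_ob N) (lm_ob K))).
exact: coaction_tensA.
Qed.

Lemma lie_comodule_tens1X (M : lie_comodule L) :
  lie_comodule_tens lie_comodule_unit M = M.
Proof.
apply: (@lie_comodule_eq (lie_comodule_tens lie_comodule_unit M) M
  (tens1X (lm_ob M))).
exact: coaction_tens1.
Qed.

Lemma lie_comodule_tensX1 (M : lie_comodule L) :
  lie_comodule_tens M lie_comodule_unit = M.
Proof.
apply: (@lie_comodule_eq (lie_comodule_tens M lie_comodule_unit) M
  (tensX1 (lm_ob M))).
exact: coaction_tensX1.
Qed.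

Lemma lmh_tensA (M N K : lie_comodule_cat) (e : _) :
  lmh (@eqm lie_comodule_cat (lie_comodule_tens (lie_comodule_tens M N) K)
    (lie_comodule_tens M (lie_comodule_tens N K)) e : lie_comodule_hom _ _)
  = eqm (tensA (lm_ob M) (lm_ob N) (lm_ob K)).
Proof. exact: lmh_eqm. Qed.

Lemma lmh_tens1X (M : lie_comodule_cat) (e : _) :
  lmh (@eqm lie_comodule_cat (lie_comodule_tens lie_comodule_unit M) M e
    : lie_comodule_hom _ _)
  = eqm (tens1X (lm_ob M)).
Proof. exact: lmh_eqm. Qed.

Lemma lmh_tensX1 (M : lie_comodule_cat) (e : _) :
  lmh (@eqm lie_comodule_cat (lie_comodule_tens M lie_comodule_unit) M e
    : lie_comodule_hom _ _)
  = eqm (tensX1 (lm_ob M)).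
Proof. exact: lmh_eqm. Qed.

Definition CMod : strict_monoidal.
Proof.
refine (@StrictMonoidal lie_comodule_cat lie_comodule_bifunctor
  lie_comodule_unit
  lie_comodule_tensA lie_comodule_tens1X lie_comodule_tensX1 _ _ _).
- move=> M M' N N' K K' f g h; apply: lie_comodule_hom_ext => /=.
  by rewrite !lmh_tensA tensmA.
- move=> M M' f; apply: lie_comodule_hom_ext => /=.
  by rewrite !lmh_tens1X tens1m.
- move=> M M' f; apply: lie_comodule_hom_ext => /=.
  by rewrite !lmh_tensX1 tensm1.
Defined.

End Categories.

(* A right module category over D, on the category M, with action F. *)
Record module_structure (D : strict_monoidal) (M : category)
    (F : bifunctor M D M) := ModuleStructure {
  act_assoc : forall Z X Y, mor (F Z (X ⊗ Y)) (F (F Z X) Y);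
  act_unit : forall Z, mor (F Z unit_ob) Z;
  act_assoc_iso : forall Z X Y, is_iso (act_assoc Z X Y);
  act_unit_iso : forall Z, is_iso (act_unit Z);
  act_assoc_nat : forall Z Z' X X' Y Y'
      (f : mor Z Z') (g : mor X X') (h : mor Y Y'),
    act_assoc Z' X' Y' ∘ bf_hom F f (g ⊠ h)
    = bf_hom F (bf_hom F f g) h ∘ act_assoc Z X Y;
  act_unit_nat : forall Z Z' (f : mor Z Z'),
    act_unit Z' ∘ bf_hom F f (idm unit_ob) = f ∘ act_unit Z;
  act_pentagon : forall Z X Y W,
    bf_hom F (act_assoc Z X Y) (idm W) ∘ act_assoc Z (X ⊗ Y) W
    = act_assoc (F Z X) Y W ∘ act_assoc Z X (Y ⊗ W)
        ∘ bf_hom F (idm Z) (asc X Y W);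
  act_triangle : forall Z X,
    bf_hom F (act_unit Z) (idm X) ∘ act_assoc Z unit_ob X
    = bf_hom F (idm Z) (lun X) }.

Definition strict_module (D : strict_monoidal) (M : category)
    (F : bifunctor M D M) (S : module_structure F) : Prop :=
  (forall Z X Y, exists e : F Z (X ⊗ Y) = F (F Z X) Y,
     act_assoc S Z X Y = eqm e)
  /\ (forall Z, exists e : F Z unit_ob = Z, act_unit S Z = eqm e).

(* p ◁ ν; it does not depend on ν. *)
Definition act_p (C : strict_symmetric) (A M W : C) (p : mor M (M ⊗ A)) :
    mor (M ⊗ W) ((M ⊗ W) ⊗ A) :=
  ascV M W A ∘ (idm M ⊠ braid A W) ∘ asc M A W ∘ (p ⊠ idm W).

(* q ◁ ν; it also depends on p and J. *)
Definition act_q (R : realType) (C : tensor_category R) (A L K M W : C)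
    (J : mor (A ⊗ K) L) (p : mor M (M ⊗ A)) (q : mor M (M ⊗ L))
    (nu : mor W (W ⊗ K)) : mor (M ⊗ W) ((M ⊗ W) ⊗ L) :=
  ascV M W L ∘ (idm M ⊠ braid L W) ∘ asc M L W ∘ (q ⊠ idm W)
  + (idm (M ⊗ W) ⊠ J) ∘ mid_braid M A W K ∘ (p ⊠ nu).

Section Action.
Context {R : realType} {C : tensor_category R}.
Context (P : lie_rinehart C) (K : lie_comonoid C).
Context (J : mor (lr_A P ⊗ K) (lr_L P)).

Definition action_ob_wf : Prop :=
  forall (M : weak_comodule P) (W : lie_comodule K),
    is_weak_comodule (act_p W (wc_p M))
                     (act_q J (wc_p M) (wc_q M) (lm_coact W)).

Definition action_hom_wf : Prop :=
  forall (M M' : weak_comodule P) (W W' : lie_comodule K)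
      (f : weak_comodule_hom M M') (g : lie_comodule_hom W W'),
    is_coaction_hom (act_p W (wc_p M)) (act_p W' (wc_p M')) (wch f ⊠ lmh g)
    /\ is_coaction_hom (act_q J (wc_p M) (wc_q M) (lm_coact W))
         (act_q J (wc_p M') (wc_q M') (lm_coact W')) (wch f ⊠ lmh g).

Definition action_ob (Hob : action_ob_wf) (M : WCMod P) (W : CMod K) :
    WCMod P :=
  @WeakComodule R C P (wc_ob M ⊗ lm_ob W) (act_p (lm_ob W) (wc_p M))
    (act_q J (wc_p M) (wc_q M) (lm_coact W)) (Hob M W).

Definition action_hom (Hob : action_ob_wf) (Hhom : action_hom_wf)
    (M M' : WCMod P) (W W' : CMod K) (f : mor M M') (g : mor W W') :
    mor (action_ob Hob M W) (action_ob Hob M' W') :=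
  @WeakComoduleHom R C P (action_ob Hob M W) (action_ob Hob M' W')
    (wch f ⊠ lmh g) (Hhom M M' W W' f g).1 (Hhom M M' W W' f g).2.

(* F is the bifunctor F_J; that p ◁ ν and q ◁ ν are coactions of the required
   kind, and f ⊗ g a homomorphism for them, is part of the assertion. *)
Definition is_cocrossed_action (F : bifunctor (WCMod P) (CMod K) (WCMod P)) :
    Prop :=
  exists (Hob : action_ob_wf) (Hhom : action_hom_wf) Hid Hcomp,
    F = @Bifunctor _ _ _ (action_ob Hob) (action_hom Hob Hhom) Hid Hcomp.

End Action.

(* Main.v *)
(* A coaction p : M → M ⊗ A is encoded by its family p_Z : M ⊗ Z → M ⊗ (A ⊗ Z)
   on right-nested words, as in [fam]. There, q ◁ ν is the sum of q carried past
   W by the braiding ([shift]) and of a crossed term containing J. Expanding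
   (q ◁ ν ⊗ id) ∘ (q ◁ ν), the shift-shift part satisfies the Lie comodule equation
   because q does; in the mixed parts, exchanging p and q by the weak comodule axiom produces the
   two anchor terms of the equation of J, and the J-J part gives its 𝔡 term
   through coassociativity and cocommutativity of A and the comodule axiom of ν.
   Strictness holds because the coactions on (M ⊗ W) ⊗ N and on M ⊗ (W ⊗ N)
   induce the same family on words M ⊗ (W ⊗ (N ⊗ Z)). *)
From mathcomp Require Import all_boot all_order all_algebra ssrAC.
From mathcomp Require Import boolp reals.
From mathcomp Require Import complex.
From HB Require Import structures.
Require Import Defs.

Set Implicit Arguments.
Unset Strict Implicit.
Unset Printing Implicit Defensive.

Import GRing.Theory.
Local Open Scope ring_scope.
Local Open Scope cat_scope.

Local Notation "X ⋉ f" := (idm X ⊠ f)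
  (at level 31, right associativity) : cat_scope.

(** * Families of coactions on right-nested words *)

Section FamilyCalculus.
Context {C : strict_monoidal}.
Implicit Types M N X Y Z W A : C.

Lemma tensr_asc_inj M X Y Z W (f g : mor W (M ⊗ ((X ⊗ Y) ⊗ Z))) :
  (M ⋉ asc X Y Z) ∘ f = (M ⋉ asc X Y Z) ∘ g -> f = g.
Proof.
move=> /(congr1 (mcomp (M ⋉ ascV X Y Z))).
by rewrite !compA -!tensr_comp ascK bf_id !comp1m.
Qed.

(** The pentagon absorbs the associators, so iterated coactions become plain composites of
    families. *)
Lemma fam_comp M N Q X Y (p : mor M (N ⊗ X)) (q : mor Q (M ⊗ Y)) Z :
  (N ⋉ asc X Y Z) ∘ fam (asc N X Y ∘ (p ⊠ idm Y) ∘ q) Z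
  = fam p (Y ⊗ Z) ∘ fam q Z.
Proof.
rewrite fam.unlock !tensl_comp -!compA [in RHS](reas (esym (asc_l _ _ _))).
have := pentagon N X Y Z; rewrite -!compA => H.
by rewrite (reas H) -!compA.
Qed.

Lemma fam_tensr M Q X Y A (d : mor A (X ⊗ Y)) (p : mor Q (M ⊗ A)) Z :
  (M ⋉ asc X Y Z) ∘ fam ((M ⋉ d) ∘ p) Z = (M ⋉ fam d Z) ∘ fam p Z.
Proof.
by rewrite fam.unlock !tensl_comp tensr_comp -!compA (reas (asc_m _ _ _)) -!compA.
Qed.

Lemma fam_ascV M N A X (f : mor X (M ⊗ (N ⊗ A))) Z :
  asc M N (A ⊗ Z) ∘ fam (ascV M N A ∘ f) Z = (M ⋉ asc N A Z) ∘ fam f Z.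
Proof.
rewrite fam.unlock tensl_comp !compA pentagon.
by rewrite -[X in X ∘ _]compA -tensl_comp ascVK bf_id compm1.
Qed.

Lemma fam_whisker M W X Y (f : mor W (X ⊗ Y)) Z :
  (M ⋉ asc X Y Z) ∘ fam (M ⋉ f) Z = (M ⋉ fam f Z) ∘ asc M W Z.
Proof. by rewrite fam.unlock asc_m compA -tensr_comp. Qed.

Lemma ascV_nat X X' Y Y' Z Z' (f : mor X X') (g : mor Y Y') (h : mor Z Z') :
  ascV X' Y' Z' ∘ (f ⊠ (g ⊠ h)) = ((f ⊠ g) ⊠ h) ∘ ascV X Y Z.
Proof.
apply: asc_inj; rewrite compA ascVK comp1m compA /asc tensmA -compA.
by rewrite -/(asc _ _ _) ascVK compm1.
Qed.

End FamilyCalculus.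

(** * Carrying a coaction past a further factor by the braiding *)

HB.lock Definition shift (C : strict_symmetric) (M A W : C)
    (p : mor M (M ⊗ A)) (Z : C) : mor (M ⊗ (W ⊗ Z)) (M ⊗ (W ⊗ (A ⊗ Z))) :=
  (M ⋉ bfam A W Z) ∘ fam p (W ⊗ Z).
Arguments shift {C M A} W p Z.

Section FamilyBraiding.
Context {C : strict_symmetric}.
Implicit Types M N X Y Z W A : C.

Lemma fam_braid M Q X Y (f : mor Q (M ⊗ (X ⊗ Y))) Z :
  (M ⋉ asc Y X Z) ∘ fam ((M ⋉ braid X Y) ∘ f) Z
  = (M ⋉ bfam X Y Z) ∘ ((M ⋉ asc X Y Z) ∘ fam f Z).
Proof.
rewrite fam.unlock !tensl_comp [X in _ ∘ X]compA asc_m.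
by rewrite !compA -!tensr_comp bfam_asc.
Qed.

(** The pentagon absorbs the associators of [act_p]; hence identities for p ◁ ν can be checked on
    [shift W p]. *)
Lemma fam_act_p M A W (p : mor M (M ⊗ A)) Z :
  asc M W (A ⊗ Z) ∘ fam (act_p W p) Z = shift W p Z ∘ asc M W Z.
Proof.
rewrite /act_p shift.unlock -!compA fam_ascV fam_braid; congr (_ ∘ _).
rewrite fam.unlock tensl_comp -[RHS]compA -asc_l.
have := pentagon M A W Z; rewrite -!compA => H.
by rewrite (reas H) -!compA.
Qed.

Lemma shift_nat M A W (p : mor M (M ⊗ A)) Z Z' (h : mor Z Z') :
  shift W p Z' ∘ (M ⋉ (W ⋉ h)) = (M ⋉ (W ⋉ (A ⋉ h))) ∘ shift W p Z.
Proof.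
by rewrite shift.unlock -compA fam_nat !compA -!tensr_comp bfam_r.
Qed.

(** [shift_comp], [shift_tensr] and [shift_braid] all pull out on the left the operator that carries
    the two new letters past [W]. With this common factor, quadratic identities between families
    pass to their shifts. *)
Lemma shift_comp M A B W (p : mor M (M ⊗ A)) (q : mor M (M ⊗ B)) Z :
  shift W p (B ⊗ Z) ∘ shift W q Z
  = (M ⋉ (bfam A W (B ⊗ Z) ∘ (A ⋉ bfam B W Z)))
      ∘ (fam p (B ⊗ (W ⊗ Z)) ∘ fam q (W ⊗ Z)).
Proof.
by rewrite shift.unlock -compA (reas (fam_nat _ _)) tensr_comp -!compA.
Qed.

Lemma shift_tensr M A B D W (p : mor M (M ⊗ A)) (d : mor A (B ⊗ D)) Z :
  (M ⋉ (W ⋉ fam d Z)) ∘ shift W p Z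
  = (M ⋉ (bfam B W (D ⊗ Z) ∘ (B ⋉ bfam D W Z)))
      ∘ ((M ⋉ fam d (W ⊗ Z)) ∘ fam p (W ⊗ Z)).
Proof.
by rewrite shift.unlock !compA -!tensr_comp fam_bfam compA.
Qed.

Lemma shift_braid M A B W (p : mor M (M ⊗ A)) (q : mor M (M ⊗ B)) Z :
  (M ⋉ (W ⋉ bfam A B Z)) ∘ (shift W p (B ⊗ Z) ∘ shift W q Z)
  = (M ⋉ (bfam B W (A ⊗ Z) ∘ (B ⋉ bfam A W Z)))
      ∘ ((M ⋉ bfam A B (W ⊗ Z)) ∘ (fam p (B ⊗ (W ⊗ Z)) ∘ fam q (W ⊗ Z))).
Proof.
by rewrite shift_comp !compA -!tensr_comp yang_baxter compA.
Qed.

(** The coactions [p] on [M] and [nu] on [W] act on different letters, so they commute up to the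
    order of the new letters [A] and [K]. *)
Lemma shift_fam M A W K (p : mor M (M ⊗ A)) (nu : mor W (W ⊗ K)) Z :
  (M ⋉ fam nu (A ⊗ Z)) ∘ shift W p Z
  = (M ⋉ (W ⋉ bfam A K Z)) ∘ (shift W p (K ⊗ Z) ∘ (M ⋉ fam nu Z)).
Proof.
rewrite shift.unlock -!compA fam_nat !compA -!tensr_comp.
by rewrite fam_bfam_r -!compA.
Qed.

End FamilyBraiding.

(** * The morphism [J] on right-nested words *)

HB.lock Definition jfam (C : strict_monoidal) (A K L : C) (J : mor (A ⊗ K) L)
    (Z : C) : mor (A ⊗ (K ⊗ Z)) (L ⊗ Z) :=
  (J ⊠ idm Z) ∘ ascV A K Z.
Arguments jfam {C A K L} J Z.

Section CrossedFamilies.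
Context {C : strict_symmetric} {A K L : C} (J : mor (A ⊗ K) L).
Implicit Types M N X Y Z W : C.

Lemma jfam_asc Z : jfam J Z ∘ asc A K Z = J ⊠ idm Z.
Proof. by rewrite jfam.unlock -compA ascK compm1. Qed.

Lemma jfam_nat Z Z' (h : mor Z Z') :
  jfam J Z' ∘ (A ⋉ (K ⋉ h)) = (L ⋉ h) ∘ jfam J Z.
Proof.
by apply: asc_injr; rewrite -!compA -asc_r jfam_asc (reas (jfam_asc _)) tens_exch.
Qed.

(** Naturality moves [J] through the braiding with [X], and the hexagon splits the braiding of
    [A ⊗ K] with [X] in two. *)
Lemma jfam_bfam X Z :
  bfam L X Z ∘ jfam J (X ⊗ Z)
  = (X ⋉ jfam J Z) ∘ (bfam A X (K ⊗ Z) ∘ (A ⋉ bfam K X Z)).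
Proof.
apply: asc_injr; rewrite -!compA jfam_asc bfam_l -bfam_hexl compA -tensr_comp.
by rewrite jfam_asc.
Qed.

Lemma jfam_bfam_r X Z :
  bfam X L Z ∘ (X ⋉ jfam J Z)
  = jfam J (X ⊗ Z) ∘ ((A ⋉ bfam X K Z) ∘ bfam X A (K ⊗ Z)).
Proof.
have E := jfam_bfam X Z.
have H : (X ⋉ jfam J Z) = (bfam L X Z ∘ jfam J (X ⊗ Z))
    ∘ ((A ⋉ bfam X K Z) ∘ bfam X A (K ⊗ Z)).
  rewrite E -!compA [(A ⋉ bfam K X Z) ∘ _]compA -tensr_comp bfamK bf_id comp1m.
  by rewrite bfamK compm1.
by rewrite H -compA (reas (bfamK _ _ _)) comp1m.
Qed.

End CrossedFamilies.

(** * Comodule axioms and the cocrossed equation in terms of families *)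

Section AxiomFamilies.
Context {R : realType} {C : tensor_category R}.
Implicit Types M W Z : C.

(** By the triangle identity the counit law on words is the original law tensored with the identity
    of [Z]; the converse takes [Z] to be the unit object. *)
Lemma is_comoduleP (A : comonoid C) M (p : mor M (M ⊗ A)) :
  is_comodule p <->
  (forall Z, (M ⋉ fam (cm_delta A) Z) ∘ fam p Z = fam p (A ⊗ Z) ∘ fam p Z)
  /\ (forall Z, (M ⋉ (lun Z ∘ (cm_eps A ⊠ idm Z))) ∘ fam p Z = idm _).
Proof.
have E Z : (M ⋉ (lun Z ∘ (cm_eps A ⊠ idm Z))) ∘ fam p Z
    = (run M ∘ (M ⋉ cm_eps A) ∘ p) ⊠ idm Z.
  rewrite tensr_comp fam.unlock -compA (reas (esym (asc_m _ _ _))) -!compA.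
  by rewrite (reas (triangle _ _)) !tensl_comp !compA.
split=> [[H1 H2]|[H1 H2]]; split.
- by move=> Z; rewrite -fam_comp -fam_tensr H1.
- by move=> Z; rewrite E H2 bf_id.
- by apply: fam_inj => Z; apply: tensr_asc_inj; rewrite fam_comp fam_tensr.
- by apply: tens_unit_inj; rewrite -E H2 bf_id.
Qed.

Lemma coderivation_famP (A L : C) (a : mor A (A ⊗ L)) M
    (p : mor M (M ⊗ A)) (q : mor M (M ⊗ L)) :
  asc M A L ∘ (p ⊠ idm L) ∘ q
    = (M ⋉ a) ∘ p + (M ⋉ braid L A) ∘ asc M L A ∘ (q ⊠ idm A) ∘ p <->
  forall Z, fam p (L ⊗ Z) ∘ fam q Z
    = (M ⋉ fam a Z) ∘ fam p Z
      + (M ⋉ bfam L A Z) ∘ (fam q (A ⊗ Z) ∘ fam p Z).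
Proof.
have E Z : (M ⋉ asc A L Z) ∘ fam ((M ⋉ a) ∘ p
      + (M ⋉ braid L A) ∘ asc M L A ∘ (q ⊠ idm A) ∘ p) Z
    = (M ⋉ fam a Z) ∘ fam p Z
      + (M ⋉ bfam L A Z) ∘ (fam q (A ⊗ Z) ∘ fam p Z).
  by rewrite famD compDr fam_tensr -!compA fam_braid [asc M L A ∘ _]compA fam_comp.
split=> [H Z|H]; first by rewrite -E -H fam_comp.
by apply: fam_inj => Z; apply: tensr_asc_inj; rewrite E fam_comp.
Qed.

Lemma cocommutative_fam (A : comonoid C) Z :
  cocommutative A ->
  bfam A A Z ∘ fam (cm_delta A) Z = fam (cm_delta A) Z.
Proof.
move=> H; rewrite fam.unlock compA bfam_asc -compA -tensl_comp.
by rewrite H.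
Qed.

Lemma compNl X Y Z (f : mor X Y) (g : mor Y Z) :
  (- g) ∘ f = - (g ∘ f) :> mor X Z.
Proof. by apply: (addrI (g ∘ f)); rewrite -compDl !subrr comp0l. Qed.

Lemma compNr X Y Z (f : mor X Y) (g : mor Y Z) :
  g ∘ (- f) = - (g ∘ f) :> mor X Z.
Proof. by apply: (addrI (g ∘ f)); rewrite -compDr !subrr comp0r. Qed.

Lemma tensNl X X' Y Y' (f : mor X X') (g : mor Y Y') :
  (- f) ⊠ g = - (f ⊠ g) :> mor (X ⊗ Y : C) (X' ⊗ Y').
Proof. by apply: (addrI (f ⊠ g)); rewrite -tensDl !subrr tens0l. Qed.

Lemma tensNr X X' Y Y' (f : mor X X') (g : mor Y Y') :
  f ⊠ (- g) = - (f ⊠ g) :> mor (X ⊗ Y : C) (X' ⊗ Y').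
Proof. by apply: (addrI (f ⊠ g)); rewrite -tensDr !subrr tens0r. Qed.

(* The second summand of q ◁ ν. *)
Definition crossed_term (A K L M W : C) (J : mor (A ⊗ K) L) (p : mor M (M ⊗ A))
    (nu : mor W (W ⊗ K)) : mor (M ⊗ W) ((M ⊗ W) ⊗ L) :=
  (idm (M ⊗ W) ⊠ J) ∘ mid_braid M A W K ∘ (p ⊠ nu).

(** Factoring [p ⊠ nu] as [nu] followed by [p] exhibits the crossed term as an iterated coaction
    followed by [J], to which [fam_comp] and [fam_act_p] apply. *)
Lemma crossed_termE (A K L M W : C) (J : mor (A ⊗ K) L) (p : mor M (M ⊗ A))
    (nu : mor W (W ⊗ K)) :
  crossed_term J p nu = (idm (M ⊗ W) ⊠ J)
    ∘ (asc (M ⊗ W) A K ∘ (act_p W p ⊠ idm K) ∘ (ascV M W K ∘ (M ⋉ nu))).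
Proof.
have E : ascV (M ⊗ A) W K ∘ (p ⊠ idm (W ⊗ K))
    = ((p ⊠ idm W) ⊠ idm K) ∘ ascV M W K.
  by apply: asc_injr; rewrite -!compA -asc_l (reas (ascK _ _ _)) ascK comp1m compm1.
rewrite /crossed_term -compA; congr (_ ∘ _).
have -> : p ⊠ nu = (p ⊠ idm (W ⊗ K)) ∘ (M ⋉ nu).
  by rewrite -bf_comp comp1m compm1.
rewrite /mid_braid /act_p !tensl_comp -!compA.
by rewrite [ascV (M ⊗ A) W K ∘ _]compA E -!compA.
Qed.

Definition crossed_fam (A K L M W : C) (J : mor (A ⊗ K) L) (p : mor M (M ⊗ A))
    (nu : mor W (W ⊗ K)) Z : mor (M ⊗ (W ⊗ Z)) (M ⊗ (W ⊗ (L ⊗ Z))) :=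
  (M ⋉ (W ⋉ jfam J Z)) ∘ (shift W p (K ⊗ Z) ∘ (M ⋉ fam nu Z)).

Lemma fam_crossed_term (A K L M W : C) (J : mor (A ⊗ K) L) (p : mor M (M ⊗ A))
    (nu : mor W (W ⊗ K)) Z :
  asc M W (L ⊗ Z) ∘ fam (crossed_term J p nu) Z
  = crossed_fam J p nu Z ∘ asc M W Z.
Proof.
have E (X N : C) (g : mor X (N ⊗ (A ⊗ K))) :
    fam ((N ⋉ J) ∘ g) Z = (N ⋉ jfam J Z) ∘ ((N ⋉ asc A K Z) ∘ fam g Z).
  by rewrite fam.unlock tensl_comp compA asc_m -jfam_asc tensr_comp -!compA.
rewrite crossed_termE E fam_comp compA asc_r -compA (reas (fam_act_p _ _ _)).
by rewrite -compA fam_ascV fam_whisker /crossed_fam !compA.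
Qed.

Lemma act_qE (A K L M W : C) (J : mor (A ⊗ K) L) (p : mor M (M ⊗ A))
    (q : mor M (M ⊗ L)) (nu : mor W (W ⊗ K)) :
  act_q J p q nu = act_p W q + crossed_term J p nu.
Proof. by []. Qed.

Definition act_q_fam (A K L M W : C) (J : mor (A ⊗ K) L) (p : mor M (M ⊗ A))
    (q : mor M (M ⊗ L)) (nu : mor W (W ⊗ K)) Z :
    mor (M ⊗ (W ⊗ Z)) (M ⊗ (W ⊗ (L ⊗ Z))) :=
  shift W q Z + crossed_fam J p nu Z.

Lemma fam_act_q (A K L M W : C) (J : mor (A ⊗ K) L) (p : mor M (M ⊗ A))
    (q : mor M (M ⊗ L)) (nu : mor W (W ⊗ K)) Z :
  asc M W (L ⊗ Z) ∘ fam (act_q J p q nu) Z = act_q_fam J p q nu Z ∘ asc M W Z.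
Proof. by rewrite act_qE famD compDr fam_act_p fam_crossed_term -compDl. Qed.

(** The word form of [J ⊠ J] after the middle braiding and Δ ⊗ id: the last term of the cocrossed
    equation before 𝔡 is precomposed. *)
Definition jjfam (A : comonoid C) (K L : C) (J : mor (A ⊗ K) L) Z :
    mor (A ⊗ (K ⊗ (K ⊗ Z))) (L ⊗ (L ⊗ Z)) :=
  jfam J (L ⊗ Z) ∘ ((A ⋉ (K ⋉ jfam J Z)) ∘ shift K (cm_delta A) (K ⊗ Z)).

(** The first term of the cocrossed equation is [J] after [act_p] of the anchor, and the last is [J]
    after the crossed term of Δ and 𝔡, so the families of both are known. The middle term is
    reassociated directly by the pentagon. *)
Lemma cocrossed_fam (P : lie_rinehart C) (K : lie_comonoid C)
    (J : mor (lr_A P ⊗ K) (lr_L P)) Z : cocrossed_hom J ->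
  fam (cobr (lr_L P)) Z ∘ jfam J Z
  = jfam J (lr_L P ⊗ Z) ∘ ((lr_A P ⋉ bfam (lr_L P) K Z) ∘ fam (lr_a P) (K ⊗ Z))
    - (lr_L P ⋉ jfam J Z)
        ∘ (bfam (lr_A P) (lr_L P) (K ⊗ Z) ∘ fam (lr_a P) (K ⊗ Z))
    + jjfam J Z ∘ (lr_A P ⋉ fam (cobr K) Z).
Proof.
move=> H; apply: asc_injr.
have E1 f : asc (lr_L P) (lr_L P) Z ∘ (((J ⊠ idm (lr_L P)) ∘ f) ⊠ idm Z)
    = jfam J (lr_L P ⊗ Z) ∘ (asc (lr_A P) K (lr_L P ⊗ Z) ∘ fam f Z)
    :> mor ((lr_A P ⊗ K) ⊗ Z) _.
  by rewrite tensl_comp compA asc_l fam.unlock compA jfam_asc compA.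
have E2 : fam (lr_a P) (K ⊗ Z) ∘ asc (lr_A P) K Z
    = asc (lr_A P) (lr_L P) (K ⊗ Z) ∘ (asc (lr_A P ⊗ lr_L P) K Z
        ∘ ((lr_a P ⊠ idm K) ⊠ idm Z)).
  by rewrite fam.unlock -compA -asc_l.
rewrite !compDl compNl -!compA jfam_asc.
rewrite {1}fam.unlock -compA -tensl_comp H !tensDl tensNl !compDr compNr.
congr (_ - _ + _).
- rewrite -!compA E1; have := fam_act_p K (lr_a P) Z.
  by rewrite /act_p -!compA => ->; rewrite shift.unlock -!compA.
- rewrite E2 (reas (bfam_asc _ _ _)) -!compA.
  rewrite !tensl_comp (reas (asc_m _ _ _)) -jfam_asc tensr_comp -!compA.
  congr (_ ∘ _); rewrite [in RHS](reas (esym (asc_l _ _ _))) -!compA.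
  have := pentagon (lr_L P) (lr_A P) K Z; rewrite -!compA => H'.
  by rewrite [in RHS](reas H') -!compA.
- have -> : J ⊠ J = (J ⊠ idm (lr_L P)) ∘ (idm _ ⊠ J).
    by rewrite -bf_comp comp1m compm1.
  rewrite -!compA E1; have := fam_crossed_term J (cm_delta (lr_A P)) (cobr K) Z.
  by rewrite /crossed_term -!compA => ->.
Qed.

End AxiomFamilies.

(** * The coactions on [M ⊗ W] form a weak comodule *)

Section ActionObjects.
Context {R : realType} {C : tensor_category R}.
Implicit Types M W Z : C.

Lemma shift_comodule (A : comonoid C) M W (p : mor M (M ⊗ A)) Z :
  is_comodule p ->
  (M ⋉ (W ⋉ fam (cm_delta A) Z)) ∘ shift W p Z = shift W p (A ⊗ Z) ∘ shift W p Z.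
Proof. by move=> /is_comoduleP[H _]; rewrite shift_tensr shift_comp H. Qed.

(** Keeping [a] arbitrary covers both the weak comodule axiom and, with [p] equal to [q] and [a] the
    cobracket, the Lie comodule equation. *)
Lemma shift_coderivation (A L : C) (a : mor A (A ⊗ L)) M W
    (p : mor M (M ⊗ A)) (q : mor M (M ⊗ L)) Z :
  (forall Z, fam p (L ⊗ Z) ∘ fam q Z
    = (M ⋉ fam a Z) ∘ fam p Z
      + (M ⋉ bfam L A Z) ∘ (fam q (A ⊗ Z) ∘ fam p Z)) ->
  shift W p (L ⊗ Z) ∘ shift W q Z
    = (M ⋉ (W ⋉ fam a Z)) ∘ shift W p Z
      + (M ⋉ (W ⋉ bfam L A Z)) ∘ (shift W q (A ⊗ Z) ∘ shift W p Z).
Proof.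
move=> H; rewrite shift_tensr shift_braid shift_comp.
by rewrite -compDr -H.
Qed.

Lemma shift_lie (L : lie_comonoid C) M W (q : mor M (M ⊗ L)) Z :
  is_lie_comodule q ->
  shift W q (L ⊗ Z) ∘ shift W q Z
    = (M ⋉ (W ⋉ fam (cobr L) Z)) ∘ shift W q Z
      + (M ⋉ (W ⋉ bfam L L Z)) ∘ (shift W q (L ⊗ Z) ∘ shift W q Z).
Proof. by move=> /is_lie_comoduleP H; apply: shift_coderivation. Qed.

Lemma act_p_comodule (A : comonoid C) M W (p : mor M (M ⊗ A)) :
  is_comodule p -> is_comodule (act_p W p).
Proof.
move=> Hp; apply/is_comoduleP; split=> Z; apply: asc_inj.
  rewrite !compA asc_r -!compA (reas (fam_act_p _ _ _)) -!compA !fam_act_p.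
  by rewrite !compA shift_comodule.
rewrite compA asc_r -compA fam_act_p compA compm1 shift.unlock.
have [_ H] := (is_comoduleP p).1 Hp.
(* The counit may be applied before or after [A] passes [W], because the braiding with the unit
   object is trivial. *)
have E : (W ⋉ (lun Z ∘ (cm_eps A ⊠ idm Z))) ∘ bfam A W Z
    = lun (W ⊗ Z) ∘ (cm_eps A ⊠ idm (W ⊗ Z)).
  rewrite tensr_comp -compA -bfam_l -bfam_unit.
  by rewrite -!compA (reas (bfamK _ _ _)) comp1m.
by rewrite compA -tensr_comp E H comp1m.
Qed.

Section WeakComodule.
Context {P : lie_rinehart C} {K : lie_comonoid C}.
Context (J : mor (lr_A P ⊗ K) (lr_L P)) (M W : C).
Context (p : mor M (M ⊗ lr_A P)) (q : mor M (M ⊗ lr_L P)).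
Context (nu : mor W (W ⊗ K)).
Hypotheses (HM : is_weak_comodule p q) (Hnu : is_lie_comodule nu).
Local Notation A := (lr_A P : C).
Local Notation L := (lr_L P : C).

Let Hp : is_comodule p. Proof. by case: HM. Qed.
Let Hq : is_lie_comodule q. Proof. by case: HM. Qed.

Let Hpq Z : shift W p (L ⊗ Z) ∘ shift W q Z
    = (M ⋉ (W ⋉ fam (lr_a P) Z)) ∘ shift W p Z
      + (M ⋉ (W ⋉ bfam L A Z)) ∘ (shift W q (A ⊗ Z) ∘ shift W p Z).
Proof. by apply: shift_coderivation; case: HM => _ _ /coderivation_famP. Qed.

(** Cocommutativity as used below: the two letters [A] created by coacting twice with [p] may be
    exchanged. *)
Let Hdelta Z : shift W p (A ⊗ Z) ∘ shift W p Z
  = (M ⋉ (W ⋉ bfam A A Z)) ∘ (shift W p (A ⊗ Z) ∘ shift W p Z).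
Proof.
rewrite -shift_comodule // compA -!tensr_comp cocommutative_fam //.
exact: lr_cocomm.
Qed.

(** Both sides coact twice by [p] and once by [nu], and differ in which of the two letters [A] is
    fed to [J]; [Hdelta] exchanges them. *)
Lemma crossed_coderivation Z :
  shift W p (L ⊗ Z) ∘ crossed_fam J p nu Z
  = (M ⋉ (W ⋉ bfam L A Z)) ∘ (crossed_fam J p nu (A ⊗ Z) ∘ shift W p Z).
Proof.
rewrite /crossed_fam -!compA shift_fam (reas (shift_nat _ _ _)) -!compA.
rewrite (reas (shift_nat _ _ _)) -!compA [in LHS](reas (Hdelta _)).
rewrite !compA -!tensr_comp jfam_bfam -!compA.
by rewrite -tensr_comp bfamK bf_id compm1.
Qed.

Lemma act_q_coderivation Z :
  shift W p (L ⊗ Z) ∘ act_q_fam J p q nu Z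
  = (M ⋉ (W ⋉ fam (lr_a P) Z)) ∘ shift W p Z
    + (M ⋉ (W ⋉ bfam L A Z)) ∘ (act_q_fam J p q nu (A ⊗ Z) ∘ shift W p Z).
Proof.
rewrite /act_q_fam !(compDr, compDl) Hpq crossed_coderivation.
by rewrite addrA.
Qed.

(** Naturality pulls the exchange of the outputs back through both copies of [J]. It then exchanges
    the letters [A], which cocommutativity absorbs, and the letters [K]. *)
Lemma jjfam_braid Z :
  bfam L L Z ∘ jjfam J Z = jjfam J Z ∘ (A ⋉ bfam K K Z).
Proof.
rewrite /jjfam shift.unlock -!compA fam_nat (reas (jfam_bfam _ _ _)) -!compA.
have E : (A ⋉ bfam K L Z) ∘ ((A ⋉ (K ⋉ jfam J Z)) ∘ (A ⋉ bfam A K (K ⊗ Z)))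
    = (A ⋉ jfam J (K ⊗ Z)) ∘ (A ⋉ (A ⋉ bfam K K Z)).
  rewrite -!tensr_comp; congr (_ ⋉ _); rewrite compA jfam_bfam_r -!compA.
  by rewrite bfamK compm1.
rewrite [X in _ ∘ (_ ∘ X)](_ : _ = (A ⋉ jfam J (K ⊗ Z))
    ∘ ((A ⋉ (A ⋉ bfam K K Z)) ∘ fam (cm_delta (lr_A P)) (K ⊗ (K ⊗ Z)))); last first.
  by rewrite [RHS]compA -E -!compA.
rewrite -fam_nat [bfam A L _ ∘ _]compA jfam_bfam_r -!compA.
rewrite (reas (cocommutative_fam _ (lr_cocomm P))).
by rewrite !compA jfam_nat.
Qed.

(** Once the coactions are brought together, the comodule axiom of [p] replaces its two occurrences
    by one followed by Δ, which becomes part of [jjfam]. *)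
Lemma crossed_fam_comp Z :
  crossed_fam J p nu (L ⊗ Z) ∘ crossed_fam J p nu Z
  = (M ⋉ (W ⋉ jjfam J Z)) ∘ (shift W p (K ⊗ (K ⊗ Z))
      ∘ (M ⋉ (fam nu (K ⊗ Z) ∘ fam nu Z))).
Proof.
have Enu Z1 Z2 (h : mor Z1 Z2) : (M ⋉ fam nu Z2) ∘ (M ⋉ (W ⋉ h))
    = (M ⋉ (W ⋉ (K ⋉ h))) ∘ (M ⋉ fam nu Z1).
  by rewrite -!tensr_comp fam_nat.
rewrite /crossed_fam -!compA (reas (Enu _ _ _)) -!compA.
rewrite (reas (shift_nat _ _ _)) -!compA (reas (shift_fam _ _ _)) -!compA.
rewrite (reas (shift_nat _ _ _)) -!compA.
rewrite (reas (esym (shift_comodule _ _ Hp))) -!compA -tensr_comp.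
by rewrite !compA -!tensr_comp /jjfam shift.unlock !compA.
Qed.

(** Let t exchange the two letters [L]. The mixed terms are x and y + t x, the J-J term satisfies j
    = d + t j, and the cocrossed equation turns the cobracket term into y - t y + d. As t is an
    involution, both sides agree once t y cancels. *)
Lemma crossed_fam_lie Z : cocrossed_hom J ->
  shift W q (L ⊗ Z) ∘ crossed_fam J p nu Z
    + crossed_fam J p nu (L ⊗ Z) ∘ shift W q Z
    + crossed_fam J p nu (L ⊗ Z) ∘ crossed_fam J p nu Z
  = (M ⋉ (W ⋉ fam (cobr (lr_L P)) Z)) ∘ crossed_fam J p nu Z
    + (M ⋉ (W ⋉ bfam L L Z))
      ∘ (shift W q (L ⊗ Z) ∘ crossed_fam J p nu Z
         + crossed_fam J p nu (L ⊗ Z) ∘ shift W q Z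
         + crossed_fam J p nu (L ⊗ Z) ∘ crossed_fam J p nu Z).
Proof.
move=> HJ.
pose u := shift W p (K ⊗ Z) ∘ (M ⋉ fam nu Z).
pose v := shift W q (A ⊗ (K ⊗ Z)) ∘ u.
pose a1 := jfam J (L ⊗ Z) ∘ ((A ⋉ bfam L K Z) ∘ fam (lr_a P) (K ⊗ Z)).
have Esj : shift W q (L ⊗ Z) ∘ crossed_fam J p nu Z
    = (M ⋉ (W ⋉ (L ⋉ jfam J Z))) ∘ v.
  by rewrite /crossed_fam compA shift_nat -!compA.
(* [Hpq] exchanges the two coactions on [M]: its anchor summand yields [a1], the other one the
   exchange of [Esj]. *)
have Ejs : crossed_fam J p nu (L ⊗ Z) ∘ shift W q Z
    = (M ⋉ (W ⋉ a1)) ∘ u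
      + (M ⋉ (W ⋉ bfam L L Z)) ∘ ((M ⋉ (W ⋉ (L ⋉ jfam J Z))) ∘ v).
  rewrite /crossed_fam -!compA shift_fam (reas (shift_nat _ _ _)) -!compA.
  rewrite [shift W p _ ∘ (_ ∘ _)]compA Hpq compDl !compDr; congr (_ + _).
    by rewrite /a1 /u !compA -!tensr_comp.
  by rewrite /v /u !compA -!tensr_comp jfam_bfam_r !compA.
(* The second anchor term of the cocrossed equation is thus the first with its letters [L]
   exchanged. *)
have Ea : (L ⋉ jfam J Z) ∘ (bfam A L (K ⊗ Z) ∘ fam (lr_a P) (K ⊗ Z))
    = bfam L L Z ∘ a1.
  rewrite /a1 [RHS]compA jfam_bfam -!compA [X in _ = _ ∘ (_ ∘ X)]compA.
  by rewrite -tensr_comp bfamK bf_id comp1m.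
pose jj := crossed_fam J p nu (L ⊗ Z) ∘ crossed_fam J p nu Z.
(* The Lie comodule equation of [nu] splits off the 𝔡 term, and [jjfam_braid] turns the exchange of
   the letters [K] into one of the letters [L]. *)
have Ejj : jj
    = (M ⋉ (W ⋉ jjfam J Z)) ∘ ((M ⋉ (W ⋉ (A ⋉ fam (cobr K) Z))) ∘ u)
      + (M ⋉ (W ⋉ bfam L L Z)) ∘ jj.
  rewrite /jj crossed_fam_comp {1}(is_lie_comoduleP nu).1 // tensDr !compDr.
  congr (_ + _).
    by rewrite tensr_comp [in LHS](reas (shift_nat _ _ _)) -!compA.
  rewrite tensr_comp [in LHS](reas (shift_nat _ _ _)) -!compA.
  by rewrite !compA -!tensr_comp jjfam_braid.
have Ed : (M ⋉ (W ⋉ fam (cobr (lr_L P)) Z)) ∘ crossed_fam J p nu Z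
    = (M ⋉ (W ⋉ a1)) ∘ u - (M ⋉ (W ⋉ bfam L L Z)) ∘ ((M ⋉ (W ⋉ a1)) ∘ u)
      + (M ⋉ (W ⋉ jjfam J Z)) ∘ ((M ⋉ (W ⋉ (A ⋉ fam (cobr K) Z))) ∘ u).
  rewrite /crossed_fam compA -!tensr_comp cocrossed_fam // Ea.
  by rewrite !(tensDr, tensNr) !(compDl, compNl) /a1 !compA -!tensr_comp !compA.
rewrite -/jj Esj Ejs Ed !compDr {1}Ejj.
have BK : (M ⋉ (W ⋉ bfam L L Z)) ∘ (M ⋉ (W ⋉ bfam L L Z)) = idm _.
  by rewrite -!tensr_comp bfamK !bf_id.
rewrite (reas BK) comp1m.
move: (_ ∘ v) (_ ∘ (_ ∘ v)) (_ ∘ u) (_ ∘ (_ ∘ u)) (_ ∘ jj) (_ ∘ (_ ∘ u)).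
(* The permutation puts [- u1] and [u1] first, to cancel, and the other summands in the order of the
   left-hand side. *)
move=> v0 v1 u0 u1 j1 d; rewrite !addrA [RHS](ACl (2*5*6*1*4*3*7)) /=.
by rewrite addNr add0r.
Qed.

Lemma act_q_lie Z : cocrossed_hom J ->
  act_q_fam J p q nu (L ⊗ Z) ∘ act_q_fam J p q nu Z
  = (M ⋉ (W ⋉ fam (cobr (lr_L P)) Z)) ∘ act_q_fam J p q nu Z
    + (M ⋉ (W ⋉ bfam L L Z))
      ∘ (act_q_fam J p q nu (L ⊗ Z) ∘ act_q_fam J p q nu Z).
Proof.
move=> HJ.
have E : act_q_fam J p q nu (L ⊗ Z) ∘ act_q_fam J p q nu Z
  = shift W q (L ⊗ Z) ∘ shift W q Z
    + (shift W q (L ⊗ Z) ∘ crossed_fam J p nu Z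
       + crossed_fam J p nu (L ⊗ Z) ∘ shift W q Z
       + crossed_fam J p nu (L ⊗ Z) ∘ crossed_fam J p nu Z).
  by rewrite /act_q_fam !(compDl, compDr) !addrA.
rewrite E [X in _ = _ + X]compDr [in LHS]shift_lie // [in LHS]crossed_fam_lie //.
by rewrite [X in _ = X + _]compDr addrACA.
Qed.

Lemma act_weak_comodule : cocrossed_hom J ->
  is_weak_comodule (act_p W p) (act_q J p q nu).
Proof.
move=> HJ; split; first exact: act_p_comodule.
  apply/is_lie_comoduleP => Z; apply: asc_inj.
  rewrite compDr !(reas (asc_r _ _ _)) -!compA !(reas (fam_act_q _ _ _ _ _)).
  by rewrite -!compA !fam_act_q !compA {1}act_q_lie // compDl -!compA.
apply/coderivation_famP => Z; apply: asc_inj.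
rewrite compDr !(reas (asc_r _ _ _)) -!compA (reas (fam_act_p _ _ _)).
rewrite (reas (fam_act_q _ _ _ _ _)) -!compA fam_act_p fam_act_q.
by rewrite !compA act_q_coderivation compDl -!compA.
Qed.

End WeakComodule.
End ActionObjects.

(** * Functoriality, associativity and unit for the [A]-coaction *)

Section ActionMorphisms.
Context {C : strict_symmetric}.
Implicit Types A M W Z : C.

Lemma shift_hom A M M' W W' (p : mor M (M ⊗ A)) (p' : mor M' (M' ⊗ A))
    (f : mor M M') (g : mor W W') Z :
  is_coaction_hom p p' f ->
  shift W' p' Z ∘ (f ⊠ (g ⊠ idm Z)) = (f ⊠ (g ⊠ idm (A ⊗ Z))) ∘ shift W p Z.
Proof.
move=> /is_coaction_homP Hp; rewrite shift.unlock.
have S X X' (h : mor X X') : f ⊠ h = (f ⊠ idm X') ∘ (M ⋉ h).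
  by rewrite -bf_comp comp1m compm1.
rewrite S -compA (reas (Hp _)) -!compA fam_nat !compA.
by rewrite -!bf_comp !comp1m !compm1 bfam_m.
Qed.

Lemma act_p_hom A M M' W W' (p : mor M (M ⊗ A)) (p' : mor M' (M' ⊗ A))
    (f : mor M M') (g : mor W W') :
  is_coaction_hom p p' f -> is_coaction_hom (act_p W p) (act_p W' p') (f ⊠ g).
Proof.
move=> Hp; apply/is_coaction_homP => Z; apply: asc_inj.
rewrite compA fam_act_p -compA /asc tensmA compA (shift_hom _ _ Hp).
by rewrite [RHS]compA tensmA -!compA -fam_act_p.
Qed.

(** The two ways of reassociating to fully right-nested words agree by the pentagon, so it suffices
    that both coactions induce the same family [F] there. *)
Lemma is_coaction_hom_asc A M W N (f : mor ((M ⊗ W) ⊗ N) ((M ⊗ W) ⊗ N ⊗ A))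
    (f' : mor (M ⊗ (W ⊗ N)) (M ⊗ (W ⊗ N) ⊗ A))
    (F : forall Z, mor (M ⊗ (W ⊗ (N ⊗ Z))) (M ⊗ (W ⊗ (N ⊗ (A ⊗ Z))))) :
  (forall Z, asc M W _ ∘ (asc (M ⊗ W) N _ ∘ fam f Z)
     = F Z ∘ (asc M W _ ∘ asc (M ⊗ W) N Z)) ->
  (forall Z, (M ⋉ asc W N _) ∘ (asc M (W ⊗ N) _ ∘ fam f' Z)
     = F Z ∘ ((M ⋉ asc W N Z) ∘ asc M (W ⊗ N) Z)) ->
  is_coaction_hom f f' (asc M W N).
Proof.
move=> Hf Hf'; apply/is_coaction_homP => Z; apply/asc_inj/tensr_asc_inj.
rewrite !compA -pentagon -[RHS]compA Hf -!compA.
rewrite [asc M (W ⊗ N) _ ∘ _]compA [LHS]compA Hf'.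
by rewrite -!compA pentagon -!compA.
Qed.

Lemma shift_asc A M W N (f : mor (M ⊗ W) ((M ⊗ W) ⊗ A))
    (F : forall Z, mor (M ⊗ (W ⊗ Z)) (M ⊗ (W ⊗ (A ⊗ Z)))) Z :
  (forall Z, asc M W (A ⊗ Z) ∘ fam f Z = F Z ∘ asc M W Z) ->
  asc M W (N ⊗ (A ⊗ Z)) ∘ shift N f Z
  = (M ⋉ (W ⋉ bfam A N Z)) ∘ (F (N ⊗ Z) ∘ asc M W (N ⊗ Z)).
Proof. by move=> H; rewrite shift.unlock compA asc_r -!compA H. Qed.

(** By the hexagon, passing [W ⊗ N] means passing [W] and then [N]. *)
Lemma shift_tens A M W N (p : mor M (M ⊗ A)) Z :
  (M ⋉ asc W N (A ⊗ Z)) ∘ shift (W ⊗ N) p Z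
  = (M ⋉ (W ⋉ bfam A N Z)) ∘ (shift W p (N ⊗ Z) ∘ (M ⋉ asc W N Z)).
Proof.
rewrite shift.unlock compA -tensr_comp bfam_hex -!compA fam_nat.
by rewrite !tensr_comp -!compA.
Qed.

Lemma act_p_asc A M W N (p : mor M (M ⊗ A)) :
  is_coaction_hom (act_p N (act_p W p)) (act_p (W ⊗ N) p) (asc M W N).
Proof.
apply: (is_coaction_hom_asc
  (F := fun Z => (M ⋉ (W ⋉ bfam A N Z)) ∘ shift W p (N ⊗ Z))) => Z.
  by rewrite fam_act_p compA (shift_asc _ _ (fam_act_p _ _)) -!compA.
by rewrite fam_act_p compA shift_tens -!compA.
Qed.

Lemma act_p_unit A M (p : mor M (M ⊗ A)) :
  is_coaction_hom (act_p unit_ob p) p (run M).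
Proof.
apply/is_coaction_homP => Z; rewrite -!triangle -!compA fam_act_p shift.unlock.
by rewrite compA fam_nat !compA -tensr_comp bfam_unit.
Qed.

End ActionMorphisms.

(** * Functoriality, associativity and unit for the [L]-coaction *)

Section CrossedMorphisms.
Context {R : realType} {C : tensor_category R}.
Context {A L : C} {K : lie_comonoid C} (J : mor (A ⊗ K) L).
Implicit Types M W Z : C.

Lemma act_q_hom M M' W W' (p : mor M (M ⊗ A)) (p' : mor M' (M' ⊗ A))
    (q : mor M (M ⊗ L)) (q' : mor M' (M' ⊗ L)) (nu : mor W (W ⊗ K))
    (nu' : mor W' (W' ⊗ K)) (f : mor M M') (g : mor W W') :
  is_coaction_hom p p' f -> is_coaction_hom q q' f ->
  is_coaction_hom nu nu' g ->
  is_coaction_hom (act_q J p q nu) (act_q J p' q' nu') (f ⊠ g).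
Proof.
move=> Hp Hq /is_coaction_homP Hnu.
apply/is_coaction_homP => Z; apply: asc_inj.
rewrite compA fam_act_q -compA /asc tensmA compA [RHS]compA tensmA -!compA.
rewrite -/(asc _ _ _) fam_act_q !compA; congr (_ ∘ _).
rewrite /act_q_fam compDl compDr (shift_hom _ _ Hq); congr (_ + _).
have E : (M' ⋉ fam nu' Z) ∘ (f ⊠ (g ⊠ idm Z))
    = (f ⊠ (g ⊠ idm (K ⊗ Z))) ∘ (M ⋉ fam nu Z).
  by rewrite -!bf_comp Hnu comp1m compm1.
rewrite /crossed_fam -!compA E (reas (shift_hom _ _ Hp)) !compA.
by rewrite -!bf_comp !comp1m !compm1.
Qed.

(** Each side is a sum of three terms: [q] carried past [W] and [N], a crossed term with [nu], and a
    crossed term [G] with [nu']. The last two match the two summands of [coaction_tens nu nu']. *)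
Lemma act_q_asc M W N (p : mor M (M ⊗ A)) (q : mor M (M ⊗ L))
    (nu : mor W (W ⊗ K)) (nu' : mor N (N ⊗ K)) :
  is_coaction_hom (act_q J (act_p W p) (act_q J p q nu) nu')
    (act_q J p q (coaction_tens nu nu')) (asc M W N).
Proof.
pose G Z := (M ⋉ (W ⋉ (N ⋉ jfam J Z))) ∘ ((M ⋉ (W ⋉ bfam A N (K ⊗ Z)))
  ∘ (shift W p (N ⊗ (K ⊗ Z)) ∘ (M ⋉ (W ⋉ fam nu' Z)))).
apply: (is_coaction_hom_asc (F := fun Z =>
  (M ⋉ (W ⋉ bfam L N Z)) ∘ act_q_fam J p q nu (N ⊗ Z) + G Z)) => Z.
  rewrite fam_act_q /act_q_fam compA compDr !compDl.
  rewrite (shift_asc _ _ (fam_act_q _ _ _ _)) -!compA; congr (_ + _).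
  rewrite /G /crossed_fam compA asc_r -!compA; congr (_ ∘ _).
  rewrite [asc M W _ ∘ _]compA (shift_asc _ _ (fam_act_p _ _)) -!compA.
  by rewrite [asc M W _ ∘ _]compA asc_r -!compA.
rewrite fam_act_q compA {1}/act_q_fam compDr shift_tens.
rewrite [RHS]compA; congr (_ ∘ _).
rewrite /act_q_fam !(compDl, compDr) -!addrA -!compA; congr (_ + _).
have -> : (M ⋉ asc W N (L ⊗ Z)) ∘ crossed_fam J p (coaction_tens nu nu') Z
    = (M ⋉ (W ⋉ (N ⋉ jfam J Z))) ∘ ((M ⋉ (W ⋉ bfam A N (K ⊗ Z)))
      ∘ (shift W p (N ⊗ (K ⊗ Z)) ∘ (M ⋉ tens_fam nu nu' Z)))
      ∘ (M ⋉ asc W N Z).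
  rewrite /crossed_fam compA -tensr_comp asc_r tensr_comp -!compA; congr (_ ∘ _).
  rewrite compA shift_tens -!compA -!tensr_comp.
  by rewrite fam_coaction_tens.
rewrite /tens_fam !(tensDr, compDr, compDl) [RHS]addrC; congr (_ + _).
  by rewrite /G -!compA.
(* In the term with [nu], one side carries [A] and [K] past [N] before [J], the other carries [L]
   past [N] after [J]; [jfam_bfam] equates them. *)
rewrite /crossed_fam -!compA tensr_comp -!compA [in LHS](reas (shift_nat _ _ _)).
by rewrite !compA -!tensr_comp jfam_bfam !compA.
Qed.

(** The zero coaction kills the crossed term, leaving [act_p] of [q]. *)
Lemma act_q_unit M (p : mor M (M ⊗ A)) (q : mor M (M ⊗ L)) :
  is_coaction_hom (act_q J p q (0 : mor unit_ob (unit_ob ⊗ K))) q (run M).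
Proof.
rewrite /act_q tens0r comp0r addr0; exact: act_p_unit.
Qed.

End CrossedMorphisms.

(** * Strict module structures from equalities of objects *)

Lemma bf_hom_eqml (D E F : category) (B : bifunctor D E F) (X X' : D) (Y : E)
    (e : X = X') :
  bf_hom B (eqm e) (idm Y) = eqm (congr1 (fun T => B T Y) e).
Proof. by case: _ / e; rewrite bf_id. Qed.

Lemma bf_hom_eqmr (D E F : category) (B : bifunctor D E F) (X : D) (Y Y' : E)
    (e : Y = Y') :
  bf_hom B (idm X) (eqm e) = eqm (congr1 (fun T => B X T) e).
Proof. by case: _ / e; rewrite bf_id. Qed.

Lemma eqm_iso (D : category) (X Y : D) (e : X = Y) : is_iso (eqm e).
Proof. by exists (eqm (esym e)); rewrite !eqm_comp !eqm_id. Qed.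

(** The pentagon and the triangle compare parallel morphisms of the form [eqm _], which always
    agree; only naturality has to be supplied. *)
Lemma strict_module_exists (D : strict_monoidal) (M : category)
    (F : bifunctor M D M)
    (eA : forall Z X Y, F Z (X ⊗ Y) = F (F Z X) Y)
    (e1 : forall Z, F Z unit_ob = Z) :
  (forall Z Z' X X' Y Y' (f : mor Z Z') (g : mor X X') (h : mor Y Y'),
    eqm (eA Z' X' Y') ∘ bf_hom F f (g ⊠ h)
    = bf_hom F (bf_hom F f g) h ∘ eqm (eA Z X Y)) ->
  (forall Z Z' (f : mor Z Z'),
    eqm (e1 Z') ∘ bf_hom F f (idm unit_ob) = f ∘ eqm (e1 Z)) ->
  exists S : module_structure F, strict_module S.
Proof.
move=> natA nat1.
unshelve eexists (@ModuleStructure D M F (fun Z X Y => eqm (eA Z X Y))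
  (fun Z => eqm (e1 Z)) _ _ natA nat1 _ _).
- by move=> *; exact: eqm_iso.
- by move=> *; exact: eqm_iso.
- move=> Z X Y W; rewrite bf_hom_eqml bf_hom_eqmr !eqm_comp; exact: eqm_irr.
- move=> Z X; rewrite bf_hom_eqml bf_hom_eqmr !eqm_comp; exact: eqm_irr.
- by split=> *; eexists.
Qed.

(** * Weak comodules as a strict module category *)

Section ModuleCategory.
Context {R : realType} {C : tensor_category R}.

(** Reduces strictness on objects to the statement that the associators and unitors of the base
    category are homomorphisms for both coactions. *)
Lemma weak_comodule_eq (P : lie_rinehart C) (M N : weak_comodule P)
    (e : wc_ob M = wc_ob N) :
  is_coaction_hom (wc_p M) (wc_p N) (eqm e) ->
  is_coaction_hom (wc_q M) (wc_q N) (eqm e) -> M = N.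
Proof.
case: M N e => M p q HM [N p' q' HN] /= e; subst N.
rewrite /is_coaction_hom /= !bf_id !comp1m !compm1 => Ep Eq; subst p' q'.
by rewrite (Prop_irrelevance HM HN).
Qed.

(** Reduces naturality for weak comodules to the base category; by proof irrelevance any equality of
    the underlying objects may be used. *)
Lemma wch_eqm (P : lie_rinehart C) (M N : WCMod P) (e : M = N)
    (e' : wc_ob M = wc_ob N) :
  wch (eqm e : weak_comodule_hom M N) = eqm e'.
Proof. by case: _ / e e' => e'; rewrite (eqm_id e'). Qed.

Section Cocrossed.
Context {P : lie_rinehart C} {K : lie_comonoid C}.
Context {J : mor (lr_A P ⊗ K) (lr_L P)} (HJ : cocrossed_hom J).

Lemma cocrossed_action_ob_wf : action_ob_wf J.
Proof.
move=> M W; apply: act_weak_comodule HJ; [exact: wc_axiom | exact: lm_axiom].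
Qed.

Lemma cocrossed_action_hom_wf : action_hom_wf J.
Proof.
move=> M M' W W' f g; split; first exact: act_p_hom (wch_p f).
exact: act_q_hom (wch_p f) (wch_q f) (lmh_axiom g).
Qed.

Definition cocrossed_action : bifunctor (WCMod P) (CMod K) (WCMod P).
Proof.
refine (@Bifunctor (WCMod P) (CMod K) (WCMod P)
  (action_ob cocrossed_action_ob_wf)
  (action_hom cocrossed_action_ob_wf cocrossed_action_hom_wf) _ _).
- by move=> M W; apply: weak_comodule_hom_ext; exact: bf_id.
- move=> M M' M'' W W' W'' f' f g' g; apply: weak_comodule_hom_ext.
  exact: bf_comp.
Defined.

Lemma cocrossed_actionA (M : WCMod P) (W N : CMod K) :
  cocrossed_action M (W ⊗ N) = cocrossed_action (cocrossed_action M W) N.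
Proof.
(* The equality is reversed because [act_p_asc] and [act_q_asc] concern [asc], which goes from left
   to right nesting. *)
apply/esym; apply: (@weak_comodule_eq P
  (cocrossed_action (cocrossed_action M W) N) (cocrossed_action M (W ⊗ N))
  (tensA (wc_ob M) (lm_ob W) (lm_ob N))).
- exact: act_p_asc.
- exact: act_q_asc.
Qed.

Lemma cocrossed_action1 (M : WCMod P) : cocrossed_action M unit_ob = M.
Proof.
apply: (@weak_comodule_eq P (cocrossed_action M unit_ob) M (tensX1 (wc_ob M))).
- exact: act_p_unit.
- exact: act_q_unit.
Qed.

Lemma wch_actionA (M : WCMod P) (W N : CMod K) :
  wch (eqm (cocrossed_actionA M W N) : weak_comodule_hom _ _)
  = ascV (wc_ob M) (lm_ob W) (lm_ob N).
Proof. exact: wch_eqm. Qed.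

Lemma wch_action1 (M : WCMod P) :
  wch (eqm (cocrossed_action1 M) : weak_comodule_hom _ _) = run (wc_ob M).
Proof. exact: wch_eqm. Qed.

End Cocrossed.
End ModuleCategory.

Theorem theorem3p39 (R : realType) (C : tensor_category R)
    (P : lie_rinehart C) (K : lie_comonoid C)
    (J : mor (lr_A P ⊗ K)%cat (lr_L P)) :
  cocrossed_hom J ->
  exists F : bifunctor (WCMod P) (CMod K) (WCMod P),
    is_cocrossed_action J F
    /\ exists S : module_structure F, strict_module S.
Proof.
move=> HJ; exists (cocrossed_action HJ); split.
  exists (cocrossed_action_ob_wf HJ), cocrossed_action_hom_wf.
  (* Unification finds the two functoriality proofs by unfolding [cocrossed_action]. *)
  by do 2!eexists.
apply: (@strict_module_exists _ _ _ (cocrossed_actionA HJ) (cocrossed_action1 HJ)).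
- move=> M M' W W' N N' f g h; apply: weak_comodule_hom_ext => /=.
  by rewrite !wch_actionA ascV_nat.
- move=> M M' f; apply: weak_comodule_hom_ext => /=.
  by rewrite !wch_action1 /run tensm1.
Qed.
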